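(* For any path $\nabla_s$, $s\in[0,1]$, of connections on a complex vector bundle $E\to M$ over a smooth manifold, the restriction of the Bismut-Chern-Simons form on $LM$ to $M$ equals the Chern-Simons form: $$\rho^*BCS(\nabla_s)=CS(\nabla_s),$$ where $\rho^*$ is restriction of forms on $LM$ to $M$ along the inclusion $M\hookrightarrow LM$ of constant loops.
   Context: Loop space. $LM=C^\infty(S^1,M)$ with $S^1=\mathbb R/\mathbb Z$ is the free loop space; infinite sums of forms on $LM$ of distinct odd degrees are allowed in $\Omega^{odd}(LM)$. Paths of connections are (piecewise) smooth in $s$. Chern-Simons form. With $R_s$ the curvature of $\nabla_s$ and $\nabla'_s=\frac{\partial}{\partial s}\nabla_s\in\Omega^1(M;End(E))$, $$CS(\nabla_s)=Tr\Big(\int_0^1\sum_{n\ge1}\frac1{n!}\sum_{i=1}^n R_s\wedge\dots\wedge R_s\wedge\underbrace{\nabla'_s}_{i\text{-th}}\wedge R_s\wedge\dots\wedge R_s\ ds\Big)\in\Omega^{odd}(M)$$ ($n$ factors in each summand). Bismut-Chern-Simons form. Let $\{U_i\}$ be an open cover of $M$ with trivializations of $E|_{U_i}$, transition functions $g_{ij}$, in which $\nabla_s$ is given by matrices of 1-forms $A_{s,i}$ with curvature $R_{s,i}=dA_{s,i}+A_{s,i}\wedge A_{s,i}$, $A_{s,j}=g_{ij}^{-1}A_{s,i}g_{ij}+g_{ij}^{-1}dg_{ij}$, and $A'_{s,i}=\partial A_{s,i}/\partial s$. For $p\in\mathbb N$ and $\mathcal U=(U_{i_1},\dots,U_{i_p})$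 let $\mathcal N(p,\mathcal U)=\{\gamma\in LM:\gamma([\frac{r-1}p,\frac rp])\subset U_{i_r},\ r=1,\dots,p\}$; these sets cover $LM$. For a matrix-valued form $\omega$ on $U_i$, $\omega(t)$ is its pullback under $\gamma\mapsto\gamma(t)$, and $\iota A(t)$ is the function $\gamma\mapsto A(\gamma'(t))$. Then $BCS(\nabla_s)=\sum_{k\ge0}BCS_{2k+1}(\nabla_s)\in\Omega^{odd}(LM)$, where $BCS_{2k+1}$ is given on $\mathcal N(p,\mathcal U)$ by $$Tr\Big(\int_0^1\sum_{n_1,\dots,n_p\ge0}\ \sum_{J\subset S,\,|J|=k,\ (q,m)\in S\setminus J} g_{i_p,i_1}(\gamma(0))\wedge I_1\wedge g_{i_1,i_2}(\gamma(\tfrac1p))\wedge\cdots\wedge g_{i_{p-1},i_p}(\gamma(\tfrac{p-1}p))\wedge I_p\ ds\Big),$$ $$I_r=\int_{\frac{r-1}p\le t_1\le\dots\le t_{n_r}\le\frac rp}X_r^1(t_1)\cdots X_r^{n_r}(t_{n_r})\,dt_1\cdots dt_{n_r},$$ $S=\{(r,j):1\le r\le p,\ 1\le j\le n_r\}$, $X_r^j=R_{s,i_r}$ if $(r,j)\in J$, $X_r^j=A'_{s,i_r}$ if $(r,j)=(q,m)$, and $X_r^j=\iota A_{s,i_r}$ otherwise. It is independent of all choices. *)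

(* Defs.v *)
From HB Require Import structures.
From mathcomp Require Import all_boot all_order all_algebra.
From mathcomp Require Import complex.
From mathcomp Require Import all_classical all_reals all_analysis.

Set Implicit Arguments.
Unset Strict Implicit.
Unset Printing Implicit Defensive.

Import Order.TTheory GRing.Theory Num.Theory.
Import numFieldNormedType.Exports.

Local Open Scope classical_set_scope.
Local Open Scope ring_scope.

(* R[i] is not a normed module over R in the libraries, so limits, derivatives
   and integrals of complex functions are taken on real and imaginary parts. *)

Section Calculus.
Variable R : realType.
Local Notation C := (R[i]).

(* C^oo on an open set D: all iterated directional derivatives are Frechet
   differentiable at every point of D. *)
Definition smooth_on (V W : normedModType R) (D : set V) (f : V -> W) : Prop :=
  forall (vs : seq V) (x : V), D x ->
    differentiable (foldr (fun v (g : V -> W) => fun y => 'D_v g y) f vs) x.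

Definition csmooth_on (V : normedModType R) (D : set V) (f : V -> C) : Prop :=
  smooth_on D (fun y => complex.Re (f y) : R^o) /\
  smooth_on D (fun y => complex.Im (f y) : R^o).

Definition cderive (V : normedModType R) (v : V) (f : V -> C) (x : V) : C :=
  Complex ('D_v (fun y => complex.Re (f y) : R^o) x)
          ('D_v (fun y => complex.Im (f y) : R^o) x).

Definition cintegral (a b : R) (f : R -> C) : C :=
  Complex (\int[lebesgue_measure]_(t in `[a, b]) complex.Re (f t))
          (\int[lebesgue_measure]_(t in `[a, b]) complex.Im (f t)).

Definition climit (u : nat -> C) : C :=
  Complex (limn (fun n => complex.Re (u n) : R^o))
          (limn (fun n => complex.Im (u n) : R^o)).

Definition mxintegral N (a b : R) (F : R -> 'M[C]_N) : 'M[C]_N :=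
  \matrix_(i, j) cintegral a b (fun t => F t i j).

Definition mxlimit N (u : nat -> 'M[C]_N) : 'M[C]_N :=
  \matrix_(i, j) climit (fun n => u n i j).

Definition mxseries N (u : nat -> 'M[C]_N) : 'M[C]_N :=
  mxlimit (fun L => \sum_(0 <= n < L) u n).

(* Sum over all p-tuples (n_1, ..., n_p) of natural numbers, as the limit of
   the sums over the cubes {0, ..., L-1}^p. *)
Definition mxmultiseries N p (u : ('I_p -> nat) -> 'M[C]_N) : 'M[C]_N :=
  mxlimit (fun L => \sum_(n : {ffun 'I_p -> 'I_L}) u (fun r => n r : nat)).

End Calculus.

(* A matrix-valued form of mixed degree on a vector space V is given by its
   values on lists of vectors: its value on [:: v1; ...; vd] is the value of its
   degree-d component on (v1, ..., vd). *)

Section MixedForms.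
Variables (R : realType) (V : Type) (N : nat).
Local Notation C := (R[i]).

Definition mxform := seq V -> 'M[C]_N.

Definition form0 (a : 'M[C]_N) : mxform := fun vs => if vs is [::] then a else 0.

Definition form1 (a : V -> 'M[C]_N) : mxform :=
  fun vs => if vs is [:: v] then a v else 0.

Definition form2 (a : V -> V -> 'M[C]_N) : mxform :=
  fun vs => if vs is [:: v; w] then a v w else 0.

Definition form_add (a b : mxform) : mxform := fun vs => a vs + b vs.

(* The number of inversions of the shuffle that moves the positions selected
   by m in front of the other ones. *)
Definition inversions d (m : d.-tuple bool) : nat :=
  #|[set ij : 'I_d * 'I_d | [&& (ij.1 < ij.2)%N, ~~ tnth m ij.1 & tnth m ij.2]]|.

(* Normalised by (a /\ b)(v, w) = a v * b w - a w * b v for 1-forms. *)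
Definition wedge (a b : mxform) : mxform := fun vs =>
  \sum_(m : (size vs).-tuple bool)
    (-1) ^+ inversions m *: (a (mask m vs) *m b (mask (map negb m) vs)).

Definition form_integral (a b : R) (w : R -> mxform) : mxform :=
  fun vs => mxintegral a b (fun t => w t vs).

Definition form_series (w : nat -> mxform) : mxform :=
  fun vs => mxseries (fun n => w n vs).

(* The integral of X_1(t_1) /\ ... /\ X_n(t_n) over the simplex
   a <= t_1 <= ... <= t_n <= b. *)
Fixpoint simplex_integral (a b : R) (X : seq (R -> mxform)) : mxform :=
  if X is X1 :: X' then
    form_integral a b (fun t => wedge (X1 t) (simplex_integral t b X'))
  else form0 1%:M.

End MixedForms.

(* [param c] inverts the chart [coord c] on [dom c]; the values of these two
   maps elsewhere are irrelevant. [chart_at] selects one chart around each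
   point. *)
Record manifold (R : realType) (n : nat) := Manifold {
  point_of :> topologicalType;
  manifold_hausdorff : hausdorff_space point_of;
  manifold_second_countable : @second_countable point_of;
  chart : Type;
  dom : chart -> set point_of;
  coord : chart -> point_of -> 'rV[R]_n;
  param : chart -> 'rV[R]_n -> point_of;
  dom_open : forall c, open (dom c);
  coord_open : forall c, open (coord c @` dom c);
  coordK : forall c x, dom c x -> param c (coord c x) = x;
  coord_continuous : forall c x, dom c x -> {for x, continuous (coord c)};
  param_continuous :
    forall c y, (coord c @` dom c) y -> {for y, continuous (param c)};
  transition_smooth : forall c d,
    smooth_on (coord c @` (dom c `&` dom d)) (fun y => coord d (param c y));
  chart_at : point_of -> chart;
  chart_atP : forall x, dom (chart_at x) x
}.

Section OnManifold.
Variables (R : realType) (n : nat) (M : manifold R n).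
Local Notation C := (R[i]).

(* T_xM is identified with R^n by the chart [chart_at x]. *)
Definition tangent (x : M) : normedModType R := 'rV[R]_n.

(* The components in the chart c of a tangent vector at x, and conversely. *)
Definition to_chart (c : chart M) (x : M) (v : tangent x) : 'rV[R]_n :=
  'D_(v : 'rV[R]_n) (fun y : 'rV[R]_n => coord c (param (chart_at x) y))
    (coord (chart_at x) x).

Definition of_chart (c : chart M) (x : M) (u : 'rV[R]_n) : tangent x :=
  'D_u (fun y : 'rV[R]_n => coord (chart_at x) (param c y)) (coord c x).

Definition smooth_fun (U : set M) (f : M -> C) : Prop :=
  forall c, csmooth_on (coord c @` (dom c `&` U)) (fun y => f (param c y)).

Definition differential (f : M -> C) (x : M) (v : tangent x) : C :=
  cderive (v : 'rV[R]_n) (fun y : 'rV[R]_n => f (param (chart_at x) y))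
    (coord (chart_at x) x).

(* The value of a 1-form at the point of coordinates y, on the tangent vector
   with constant components u in the chart c. *)
Definition in_chart (c : chart M) (w : forall x : M, tangent x -> C)
    (u y : 'rV[R]_n) : C := w (param c y) (of_chart c (param c y) u).

Definition smooth_form1 (U : set M) (w : forall x : M, tangent x -> C) : Prop :=
  forall c u, csmooth_on (coord c @` (dom c `&` U)) (in_chart c w u).

(* sum_jk (d_j w_k - d_k w_j) v1_j v2_k, in the chart at x; its value does not
   depend on the chart. *)
Definition ext_derivative (w : forall x : M, tangent x -> C) (x : M)
    (v1 v2 : tangent x) : C :=
  let c := chart_at x in
  cderive (v1 : 'rV[R]_n) (in_chart c w v2) (coord c x)
  - cderive (v2 : 'rV[R]_n) (in_chart c w v1) (coord c x).

Definition diff_form := forall x : M, seq (tangent x) -> C.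

End OnManifold.

(* A bundle of rank N with an open cover (tdom i)_i by trivializations. The
   fibrewise maps [tmap i x] and [tinv i x] matter for x in [tdom i] only. *)
Record vbundle (R : realType) (n : nat) (M : manifold R n) (N : nat) := VBundle {
  fiber :> M -> lmodType R[i];
  triv : Type;
  tdom : triv -> set M;
  tmap : triv -> forall x : M, fiber x -> 'cV[R[i]]_N;
  tinv : triv -> forall x : M, 'cV[R[i]]_N -> fiber x;
  tdom_open : forall i, open (tdom i);
  tmap_linear : forall i x, tdom i x -> linear (@tmap i x);
  tmapK : forall i x, tdom i x -> cancel (@tmap i x) (@tinv i x);
  tinvK : forall i x, tdom i x -> cancel (@tinv i x) (@tmap i x);
  gtrans_smooth : forall i j a b, smooth_fun (tdom i `&` tdom j)
    (fun x => tmap i (tinv j x (delta_mx b 0)) a 0);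
  triv_at : M -> triv;
  triv_atP : forall x, tdom (triv_at x) x
}.

Section Connections.
Variables (R : realType) (n : nat) (M : manifold R n) (N : nat).
Variable E : vbundle M N.
Local Notation C := (R[i]).

Definition gtrans (i j : triv E) (x : M) : 'M[C]_N :=
  \matrix_(a, b) tmap i (tinv j x (delta_mx b 0)) a 0.

Definition frame (i : triv E) (b : 'I_N) (x : M) : E x :=
  tinv i x (delta_mx b 0).

Definition smooth_section (U : set M) (s : forall x, E x) : Prop :=
  forall i a, smooth_fun (tdom i `&` U) (fun x => tmap i (s x) a 0).

(* A covariant derivative on local sections. Sections over an open set U are
   represented by total sections that are smooth on U; [cov s] is meaningful
   only where s is smooth, and there it depends on the germ of s only. *)
Record connection := Connection {
  cov : (forall x, E x) -> forall x : M, tangent x -> E x;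
  cov_local : forall U s t, open U -> smooth_section U s ->
    smooth_section U t -> (forall x, U x -> s x = t x) ->
    forall x v, U x -> @cov s x v = @cov t x v;
  cov_linear : forall U s, open U -> smooth_section U s ->
    forall x (a : R) (v w : tangent x), U x ->
    cov s (a *: v + w) = (a%:C)%C *: cov s v + cov s w;
  cov_add : forall U s t, open U -> smooth_section U s -> smooth_section U t ->
    forall x (v : tangent x), U x ->
    cov (fun y => s y + t y) v = cov s v + cov t v;
  cov_leibniz : forall U f s, open U -> smooth_fun U f -> smooth_section U s ->
    forall x (v : tangent x), U x ->
    cov (fun y => f y *: s y) v = differential f v *: s x + f x *: cov s v;
  cov_smooth : forall U s, open U -> smooth_section U s ->
    forall i a, smooth_form1 (tdom i `&` U) (fun x v => tmap i (@cov s x v) a 0)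
}.

(* The matrix A_i of 1-forms: nabla e_b = sum_a (A_i)_ab e_a in the i-th frame. *)
Definition conn_mx (nabla : connection) (i : triv E) (x : M) (v : tangent x) :
    'M[C]_N :=
  \matrix_(a, b) tmap i (cov nabla (frame i b) v) a 0.

Definition conn_form nabla i x : mxform R (tangent x) N :=
  form1 (@conn_mx nabla i x).

Definition curvature nabla i x : mxform R (tangent x) N :=
  form_add
    (form2 (fun v w => \matrix_(a, b)
       ext_derivative (fun y u => @conn_mx nabla i y u a b) v w))
    (wedge (@conn_form nabla i x) (@conn_form nabla i x)).

Definition conn_derivative (nabla : R -> connection) (s : R) (i : triv E)
    (x : M) : mxform R (tangent x) N :=
  form1 (fun v => \matrix_(a, b)
    cderive (1 : R^o) (fun s' : R^o => @conn_mx (nabla s') i x v a b) (s : R^o)).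

Definition smooth_path (nabla : R -> connection) : Prop :=
  forall i c a b u,
    csmooth_on [set z : (R^o * 'rV[R]_n)%type |
                 (coord c @` (dom c `&` tdom i)) z.2]
      (fun z => in_chart c (fun x v => @conn_mx (nabla z.1) i x v a b) u z.2).

(* On each closed piece of a subdivision of [0, 1] the path agrees with one
   that is smooth on the whole line, i.e. it is smooth up to the endpoints of
   the piece. Only the connections [nabla s] with s in [0, 1] matter. *)
Definition piecewise_smooth_path (nabla : R -> connection) : Prop :=
  exists (m : nat) (sigma : nat -> R) (D : nat -> R -> connection),
    [/\ sigma 0%N = 0, sigma m = 1 &
      forall k, (k < m)%N ->
        [/\ sigma k < sigma k.+1, smooth_path (D k) &
          forall s i x v, sigma k <= s <= sigma k.+1 -> tdom i x ->
            @conn_mx (nabla s) i x v = @conn_mx (D k s) i x v]].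

(* The End(E)-valued forms are computed in the trivialization [triv_at x],
   which does not affect the trace. *)
Definition CS (nabla : R -> connection) : diff_form M := fun x vs =>
  let R_ s := @curvature (nabla s) (triv_at E x) x in
  let A' s := @conn_derivative nabla s (triv_at E x) x in
  \tr (form_integral 0 1 (fun s =>
    form_series (fun n' => let m := n'.+1 in fun ws =>
      (m`!)%:R^-1 *: \sum_(i < m)
        (\big[@wedge R (tangent x) N/form0 1%:M]_(j < m)
           (if j == i then A' s else R_ s)) ws)) vs).

Record loop := Loop {
  loop_fun :> R -> M;
  loop_periodic : forall t, loop_fun (t + 1) = loop_fun t;
  loop_continuous : continuous loop_fun;
  loop_smooth : forall c,
    smooth_on [set t : R^o | dom c (loop_fun t)] (fun t => coord c (loop_fun t))
}.

Definition velocity (gamma : loop) (t : R) : tangent (gamma t) :=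
  'D_(1 : R^o) (fun t' : R^o => coord (chart_at (gamma t)) (gamma t')) (t : R^o).

(* T_gamma LM: smooth vector fields along gamma. Since
   gamma (t + 1) = gamma t, both tangent spaces in [field_periodic] are
   identified with R^n by the same chart. *)
Record loop_tangent (gamma : loop) := LoopTangent {
  field :> forall t, tangent (gamma t);
  field_periodic : forall t,
    (field (t + 1) : 'rV[R]_n) = (field t : 'rV[R]_n);
  field_smooth : forall c,
    smooth_on [set t : R^o | dom c (gamma t)] (fun t => to_chart c (field t))
}.

Definition loop_form := forall gamma : loop, seq (loop_tangent gamma) -> C.

(* [gamma] lies in N(p, (U_{i 0}, ..., U_{i (p-1)})); indices start at 0. *)
Definition adapted (gamma : loop) (p : nat) (i : 'I_p -> triv E) : Prop :=
  (0 < p)%N /\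
  forall (r : 'I_p) (t : R), r%:R / p%:R <= t <= r.+1%:R / p%:R ->
    tdom (i r) (gamma t).

Section BCS.
Variables (nabla : R -> connection) (gamma : loop).

(* omega(t), at gamma, for a form omega on an open subset of M *)
Definition ev_pullback (omega : forall x : M, mxform R (tangent x) N) (t : R) :
    mxform R (loop_tangent gamma) N :=
  fun xis => omega (gamma t) [seq field xi t | xi <- xis].

Definition BCS_letter p (i : 'I_p -> triv E) (s : R) (m : 'I_p -> nat)
    (J : {set {r : 'I_p & 'I_(m r)}}) (q : {r : 'I_p & 'I_(m r)})
    (r : 'I_p) (j : 'I_(m r)) (t : R) : mxform R (loop_tangent gamma) N :=
  let rj := Tagged (fun r => 'I_(m r)) j in
  if rj \in J then ev_pullback (@curvature (nabla s) (i r)) t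
  else if rj == q then ev_pullback (@conn_derivative nabla s (i r)) t
  else form0 (conn_mx (nabla s) (i r) (velocity gamma t)).

Definition BCS_block p (i : 'I_p -> triv E) (s : R) (m : 'I_p -> nat)
    (J : {set {r : 'I_p & 'I_(m r)}}) (q : {r : 'I_p & 'I_(m r)})
    (r : 'I_p) : mxform R (loop_tangent gamma) N :=
  simplex_integral (r%:R / p%:R) (r.+1%:R / p%:R)
    [seq @BCS_letter p i s m J q r j | j <- enum 'I_(m r)].

(* BCS_{2k+1} on N(p, (U_{i 0}, ..., U_{i (p-1)})). The predecessor [ord_pred]
   is cyclic, so the factor at r = 0 is g_{i (p-1), i 0} (gamma 0). *)
Definition BCS_component p (i : 'I_p -> triv E) (k : nat)
    (xis : seq (loop_tangent gamma)) : C :=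
  \tr (form_integral 0 1 (fun s => fun etas =>
    mxmultiseries (fun m : 'I_p -> nat =>
      \sum_(J : {set {r : 'I_p & 'I_(m r)}} | #|J| == k)
      \sum_(q : {r : 'I_p & 'I_(m r)} | q \notin J)
        (\big[@wedge R (loop_tangent gamma) N/form0 1%:M]_(r < p)
           wedge (form0 (gtrans (i (ord_pred r)) (i r) (gamma (r%:R / p%:R))))
                 (@BCS_block p i s m J q r)) etas)) xis).

Definition BCS_local p (i : 'I_p -> triv E) (xis : seq (loop_tangent gamma)) : C :=
  climit (fun L => \sum_(0 <= k < L) BCS_component i k xis).

End BCS.

(* BCS is given by [BCS_local] for any adapted (p, i); one such pair is chosen
   at each loop. The default branch never occurs, as by compactness of the
   circle each loop has an adapted pair. *)
Definition BCS (nabla : R -> connection) : loop_form := fun gamma xis =>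
  match pselect (exists pi : {p : nat & 'I_p -> triv E},
                   adapted gamma (projT2 pi)) with
  | left ex => BCS_local nabla (projT2 (projT1 (cid ex))) xis
  | right _ => 0
  end.

End Connections.

Lemma smooth_on_cst (R : realType) (V W : normedModType R) (D : set V) (w : W) :
  smooth_on D (fun _ : V => w).
Proof.
move=> vs x _.
suff [a ->] : exists a : W,
    foldr (fun v (g : V -> W) => fun y => 'D_v g y) (fun=> w) vs = cst a.
  exact: differentiable_cst.
elim: vs => [|v vs [a IH]] /=; first by exists w.
by exists 0; rewrite IH; apply/funext => y; rewrite derive_cst.
Qed.

Section ConstantLoops.
Variables (R : realType) (n : nat) (M : manifold R n).

Definition constant_loop (x : M) : loop M.
Proof.
apply: (@Loop R n M (fun=> x)) => //; first by move=> t; exact: cvg_cst.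
by move=> c; apply: (@smooth_on_cst R R^o).
Defined.

(* The differential of the inclusion of constant loops: v is sent to the
   constant field v. *)
Definition constant_field (x : M) (v : tangent x) :
  loop_tangent (constant_loop x).
Proof.
apply: (@LoopTangent R n M (constant_loop x) (fun=> v)) => // c.
exact: (@smooth_on_cst R R^o 'rV[R]_n _ (to_chart c v)).
Defined.

Definition restrict_to_constant (beta : loop_form M) : diff_form M :=
  fun x vs => beta (constant_loop x) [seq constant_field v | v <- vs].

End ConstantLoops.

(* Main.v *)
Require Import Defs.
From HB Require Import structures.
From mathcomp Require Import all_boot all_order all_algebra.
From mathcomp Require Import complex ring.
From mathcomp Require Import all_classical all_reals all_analysis.
From mathcomp Require Import measurable_realfun.

(** On a constant loop every letter [iota A] vanishes, since [A] is evaluated on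
the zero velocity. The surviving terms of [BCS_{2k+1}] are therefore words of
length [k + 1] with one letter [A'_s] and [k] letters [R_s], all with constant
coefficients in [t]. The change of frame [A_j = g^-1 A_i g + g^-1 dg] gives
[R_j = g^-1 R_i g] and [A'_j = g^-1 A'_i g], so the transition functions
telescope to a conjugation by one matrix that does not depend on [s]. An
iterated integral of constants over a simplex of side [1/p] with [n_r] variables
is [p^(-n_r) / n_r!], and by the multinomial theorem these volumes add up, over
[n_1 + ... + n_p = k + 1], to [1 / (k + 1)!]: the coefficient in the
Chern-Simons form. The final conjugation is removed by the trace, once it has
been moved out of the integral over [s]; this uses that the integrand is
piecewise continuous in [s]. The breakpoints of the path, where the derivative
in [s] carries no information, form a null set. *)

(* [coord] has to denote the chart coordinates, not [vector.coord]. *)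
Import Defs.

(** At a constant loop [BCS] may have chosen any trivializations around [x], unrelated to
    [triv_at E x]. All of them are compared with this one reference frame: the cocycle relation
    makes each transition function pass through it, so that neighbouring blocks cancel although
    their frames differ.

    The inhomogeneous term g^-1 dg is the obstacle in both transformation laws. It leaves A' because
    it does not depend on s, and it leaves R because second derivatives of g in a chart commute;
    this is why Schwarz's theorem is proved along the way.

    The series raise no question of convergence. The length of a list of vectors is the degree, and
    length 2k + 1 selects the same k on both sides; for a fixed k only the finitely many tuples of
    sum k + 1 contribute. Every series is therefore the limit of an eventually constant sequence.

    The integral is defined for arbitrary functions but is additive only on integrable ones, so each
    identity between integrands has to be accompanied by regularity in s, piece by piece. *)

Set Implicit Arguments.
Unset Strict Implicit.
Unset Printing Implicit Defensive.

Import Order.TTheory GRing.Theory Num.Theory.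
Import numFieldNormedType.Exports.

Local Open Scope classical_set_scope.
Local Open Scope ring_scope.

(** * The wedge product as a ring *)

Section Wedge.
Variables (R : realType) (V : Type) (N : nat).
Local Notation C := (R[i]).
Local Notation form := (mxform R V N).
Implicit Types (a b c : form) (v : V) (vs : seq V).

HB.instance Definition _ := GRing.Lmodule.copy form (seq V -> 'M[C]_N).

Lemma form_addE a b vs : (a + b) vs = a vs + b vs. Proof. by []. Qed.
Lemma form_scaleE (k : C) a vs : (k *: a) vs = k *: a vs. Proof. by []. Qed.
Lemma form_sumE I (r : seq I) (P : pred I) (F : I -> form) vs :
  (\sum_(i <- r | P i) F i) vs = \sum_(i <- r | P i) F i vs.
Proof. by elim/big_rec2: _ => // i y x _ <-. Qed.

Definition interior_product v a : form := fun vs => a (v :: vs).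
(** The Koszul sign of a vector moved past the arguments of [a]. It makes sense in mixed degree
    because the length of the list is the degree. *)
Definition grading a : form := fun vs => (-1) ^+ size vs *: a vs.

Lemma inversionsE d (m : d.-tuple bool) : inversions m =
  (\sum_(i < d) \sum_(j < d) [&& i < j, ~~ tnth m i & tnth m j])%N.
Proof.
rewrite /inversions -sum1_card pair_bigA big_mkcond /=.
by apply: eq_bigr => -[i j] _; rewrite unfold_in /= asboolb; case: ifP.
Qed.

(** A leading vector that goes to the second factor is overtaken by each of the [count id m] vectors
    of the first one; if it goes to the first factor, nothing overtakes it. *)
Lemma inversions_cons d (x : bool) (m : d.-tuple bool) :
  inversions [tuple of x :: m] = (~~ x * count id m + inversions m)%N.
Proof.
rewrite !inversionsE big_ord_recl; congr (_ + _)%N.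
  rewrite big_ord_recl /= add0n; under eq_bigr do rewrite tnthS /=.
  case: x => /=; first by rewrite big1.
  rewrite mul1n -sum1_count big_tuple [RHS]big_mkcond /=.
  by apply: eq_bigr => j _; case: (tnth m j).
apply: eq_bigr => i _; rewrite big_ord_recl /= add0n.
by apply: eq_bigr => j _; rewrite !tnthS.
Qed.

Lemma wedge_nil a b : wedge a b [::] = a [::] *m b [::].
Proof.
rewrite /wedge /= (bigD1 [tuple]) //= big1 => [|m]; last by rewrite (tuple0 m).
by rewrite inversionsE big_ord0 expr0 scale1r addr0.
Qed.

(** Leibniz rule for the interior product: the first bit of the shuffle decides which factor
    receives [v], and on its way to [b] it passes the arguments of [a]. This recursion replaces sums
    over shuffles in the inductions below. *)
Lemma wedge_cons a b v vs : wedge a b (v :: vs) =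
  wedge (interior_product v a) b vs + wedge (grading a) (interior_product v b) vs.
Proof.
rewrite /wedge /=.
rewrite (reindex (fun xm : bool * (size vs).-tuple bool => [tuple of xm.1 :: xm.2])) /=;
  last first.
  exists (fun m => (thead m, [tuple of behead m])) => [[x m] _|m _] /=.
    by rewrite theadE; congr pair; apply/val_inj.
  by case/tupleP: m => x m; rewrite theadE; apply/val_inj.
rewrite -(pair_bigA _ (fun (x : bool) (m : (size vs).-tuple bool) =>
   (-1) ^+ inversions [tuple of x :: m] *:
   (a (mask (x :: m) (v :: vs)) *m b (mask (map negb (x :: m)) (v :: vs))))) /=.
rewrite big_bool /=; congr (_ + _); apply: eq_bigr => m _.
  by rewrite inversions_cons mul0n.
rewrite inversions_cons mul1n exprD /grading /interior_product size_mask ?size_tuple//.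
by rewrite -scalemxAl scalerA mulrC.
Qed.

Lemma wedgeDl a a' b : wedge (a + a') b = wedge a b + wedge a' b.
Proof.
apply/funext => vs; rewrite form_addE /wedge -big_split.
by apply: eq_bigr => m _; rewrite mulmxDl scalerDr.
Qed.

Lemma wedgeDr a b b' : wedge a (b + b') = wedge a b + wedge a b'.
Proof.
apply/funext => vs; rewrite form_addE /wedge -big_split.
by apply: eq_bigr => m _; rewrite mulmxDr scalerDr.
Qed.

Lemma wedgeZl (k : C) a b : wedge (k *: a) b = k *: wedge a b.
Proof.
apply/funext => vs; rewrite form_scaleE /wedge scaler_sumr.
by apply: eq_bigr => m _; rewrite -scalemxAl !scalerA mulrC.
Qed.

Lemma wedgeZr (k : C) a b : wedge a (k *: b) = k *: wedge a b.
Proof.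
apply/funext => vs; rewrite form_scaleE /wedge scaler_sumr.
by apply: eq_bigr => m _; rewrite -scalemxAr !scalerA mulrC.
Qed.

Lemma wedge_form0l (x : 'M[C]_N) b vs : wedge (form0 x) b vs = x *m b vs.
Proof.
elim: vs b => [|v vs IH] b; first by rewrite wedge_nil.
(* The zero form is written as a multiple, so that [wedgeZl] removes it; the ring laws come
   later. *)
rewrite wedge_cons (_ : interior_product v _ = 0 *: (form0 0)); last first.
  by apply/funext => us; rewrite form_scaleE scale0r.
rewrite wedgeZl form_scaleE scale0r add0r (_ : grading _ = form0 x) ?IH//.
by apply/funext => -[|u us]; rewrite /grading /= ?expr0 ?scale1r ?scaler0.
Qed.

Lemma wedge_form0r a (x : 'M[C]_N) vs : wedge a (form0 x) vs = a vs *m x.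
Proof.
elim: vs a => [|v vs IH] a; first by rewrite wedge_nil.
rewrite wedge_cons IH (_ : interior_product v (form0 x) = 0 *: (form0 0))
  ?wedgeZr ?form_scaleE ?scale0r ?addr0//.
Qed.

Lemma grading_wedge a b : grading (wedge a b) = wedge (grading a) (grading b).
Proof.
apply/funext => vs; rewrite /grading /wedge scaler_sumr; apply: eq_bigr => m _.
rewrite -scalemxAl -scalemxAr !scalerA; congr (_ *: _).
rewrite mulrC -mulrA -exprD !size_mask ?size_map ?size_tuple// count_map.
by rewrite count_predC size_tuple.
Qed.

(* The interior product is a derivation twisted by the grading, so the two sides satisfy
   the same recursion. *)
Lemma wedgeA : associative (@wedge R V N).
Proof.
move=> a b c; apply/funext => vs; elim: vs a b c => [|v vs IH] a b c.
  by rewrite !wedge_nil mulmxA.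
have interior_product_wedge x y : interior_product v (wedge x y) =
    wedge (interior_product v x) y + wedge (grading x) (interior_product v y).
  by apply/funext => us; rewrite /interior_product wedge_cons.
rewrite !wedge_cons !interior_product_wedge grading_wedge wedgeDr wedgeDl !form_addE.
by rewrite !IH addrA.
Qed.

Lemma wedge1l : left_id (form0 1%:M) (@wedge R V N).
Proof. by move=> a; apply/funext => vs; rewrite wedge_form0l mul1mx. Qed.

Lemma wedge1r : right_id (form0 1%:M) (@wedge R V N).
Proof. by move=> a; apply/funext => vs; rewrite wedge_form0r mulmx1. Qed.

(** The ring is in general noncommutative, and it is the zero ring when [N] is 0. The big operators
    over [wedge] in the definitions are ring products by conversion. *)
HB.instance Definition _ := GRing.Zmodule_isPzRing.Build form
  wedgeA wedge1l wedge1r wedgeDl wedgeDr.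
Lemma wedgeE a b : wedge a b = a * b. Proof. by []. Qed.

Lemma form_scalerAl (k : C) a b : (k *: a) * b = k *: (a * b).
Proof. exact: wedgeZl. Qed.

Lemma form_scalerAr (k : C) a b : a * (k *: b) = k *: (a * b).
Proof. exact: wedgeZr. Qed.

Lemma form_prodZ I (r : seq I) (k : I -> C) (F : I -> form) :
  \prod_(i <- r) (k i *: F i) = (\prod_(i <- r) k i) *: \prod_(i <- r) F i.
Proof.
elim: r => [|i r IH]; first by rewrite !big_nil scale1r.
by rewrite !big_cons IH form_scalerAl form_scalerAr scalerA.
Qed.

Lemma form0M (x y : 'M[C]_N) : form0 x * form0 y = form0 (x *m y) :> form.
Proof.
by apply/funext => -[|v vs]; rewrite -wedgeE wedge_form0l /= ?mulmx0.
Qed.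

Definition homogeneous (d : nat) a := forall vs, size vs != d -> a vs = 0.

Lemma homogeneousM d e a b :
  homogeneous d a -> homogeneous e b -> homogeneous (d + e) (a * b).
Proof.
move=> ha hb vs; rewrite -wedgeE /wedge => /negP vs_de.
rewrite big1// => m _.
have [da|/ha ->] := eqVneq (size (mask m vs)) d; last by rewrite mul0mx scaler0.
have [eb|/hb ->] := eqVneq (size (mask (map negb m) vs)) e;
  last by rewrite mulmx0 scaler0.
case: vs_de; rewrite -da -eb !size_mask ?size_map ?size_tuple// count_map.
by rewrite count_predC size_tuple.
Qed.

Lemma homogeneous1 : homogeneous 0 1. Proof. by case. Qed.

Lemma homogeneousZ d (k : C) a : homogeneous d a -> homogeneous d (k *: a).
Proof. by move=> ha vs /ha; rewrite form_scaleE => ->; rewrite scaler0. Qed.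

End Wedge.

(** * Pullback of forms along a map of vectors *)

Section Pullback.
Variables (R : realType) (V W : Type) (N : nat) (f : V -> W).

Definition pullback (w : mxform R W N) : mxform R V N := fun vs => w (map f vs).

(** Shuffles see only the positions of the arguments, so [f] may be applied before or after;
    interior products and signs of a pullback are again pullbacks. *)
Lemma pullbackM a b : pullback (a * b) = pullback a * pullback b.
Proof.
have gradingE c : grading (pullback c) = pullback (grading c).
  by apply/funext => us; rewrite /pullback /grading size_map.
apply/funext => vs; rewrite -!wedgeE.
elim: vs a b => [|v vs IH] a b; first by rewrite /pullback /= !wedge_nil.
rewrite {1}/pullback map_cons !wedge_cons gradingE.
rewrite -[interior_product v (pullback a)]/(pullback (interior_product (f v) a)).
by rewrite -[interior_product v (pullback b)]/(pullback (interior_product (f v) b)) -!IH.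
Qed.

Lemma pullback_form0 x : pullback (form0 x) = form0 x.
Proof. by apply/funext => -[]. Qed.

Lemma pullback_prod I (r : seq I) (F : I -> mxform R W N) :
  pullback (\prod_(i <- r) F i) = \prod_(i <- r) pullback (F i).
Proof.
by apply: (big_morph _ pullbackM); rewrite pullback_form0.
Qed.
End Pullback.

(** * Words and multinomial coefficients *)

Section Words.
Variables (A : pzRingType) (a b : A).

(** The first variation of [b ^+ m] in the direction [a], that is, the coefficient of e in (b + e
    a)^m. With A' for [a] and R for [b] it is the inner sum of the Chern-Simons form. *)
Definition words m := \sum_(i < m) \prod_(j < m) (if j == i then a else b).

Lemma words0 : words 0 = 0. Proof. exact: big_ord0. Qed.

Lemma wordsS m : words m.+1 = a * b ^+ m + b * words m.
Proof.
rewrite /words big_ord_recl big_ord_recl; congr (_ * _ + _).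
  by rewrite (eq_bigr (fun=> b)) // prodr_const card_ord.
rewrite mulr_sumr; apply: eq_bigr => i _; rewrite big_ord_recl.
by congr (_ * _); apply: eq_bigr => j _; rewrite (inj_eq lift_inj).
Qed.

Lemma wordsD m m' : words (m + m') = words m * b ^+ m' + b ^+ m * words m'.
Proof.
elim: m => [|m IH]; first by rewrite words0 mul0r add0r mul1r.
by rewrite addSn !wordsS IH exprD exprS mulrDr mulrDl !mulrA addrA.
Qed.

(** Product rule for the variation of a product of powers of [b]: the letter [a] sits in exactly one
    of the [p] blocks. *)
Lemma words_sum p (m : 'I_p -> nat) :
  \sum_(r < p) \prod_(r' < p) (if r' == r then words (m r) else b ^+ m r') =
  words (\sum_(r < p) m r)%N.
Proof.
elim: p m => [|p IH] m; first by rewrite !big_ord0 words0.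
rewrite !big_ord_recl eqxx wordsD; congr (_ + _).
  by rewrite (big_morph _ (exprD b) (expr0 b)).
rewrite -IH mulr_sumr; apply: eq_bigr => r _; rewrite big_ord_recl; congr (_ * _).
Qed.

Lemma sum_prod1 (I : finType) p (r0 : 'I_p) (F : I -> A) (G : 'I_p -> A) :
  \sum_i \prod_(r < p) (if r == r0 then F i else G r) =
  \prod_(r < p) (if r == r0 then \sum_i F i else G r).
Proof.
elim: p r0 G => [[]//|p IH] r0 G.
rewrite big_ord_recl; under eq_bigr do rewrite big_ord_recl.
case: (unliftP ord0 r0) => [r1 ->|->].
  rewrite eq_liftF -mulr_sumr; congr (_ * _).
  under [RHS]eq_bigr do rewrite (inj_eq lift_inj).
  rewrite -IH; apply: eq_bigr => i _.
  by under eq_bigr do rewrite (inj_eq lift_inj).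
rewrite eqxx mulr_suml.
by apply: eq_bigr => i _; congr (_ * _); apply: eq_bigr.
Qed.

(** The index [q] is the position of [a], given as a block and a place in it. Concatenation makes
    the outcome depend on the total length alone, so that the simplex volumes can be summed
    separately. *)
Lemma sum_tagged_words p (m : 'I_p -> nat) :
  \sum_(q : {r : 'I_p & 'I_(m r)}) \prod_(r < p) \prod_(j < m r)
     (if Tagged (fun r => 'I_(m r)) j == q then a else b) =
  words (\sum_(r < p) m r)%N.
Proof.
rewrite -words_sum -(sig_big_dep xpredT (fun=> xpredT)
  (fun (r0 : 'I_p) (j0 : 'I_(m r0)) => \prod_(r < p) \prod_(j < m r)
     (if Tagged (fun r => 'I_(m r)) j == Tagged (fun r => 'I_(m r)) j0 then a else b))) /=.
apply: eq_bigr => r0 _.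
transitivity (\sum_(j0 < m r0) \prod_(r < p)
   (if r == r0 then \prod_(j < m r0) (if j == j0 then a else b) else b ^+ m r)).
  apply: eq_bigr => j0 _; apply: eq_bigr => r _.
  have [->|r_r0] := eqVneq r r0.
    by apply: eq_bigr => j _; rewrite -tag_eqE /tag_eq /= eqxx tagged_asE.
  under eq_bigr do rewrite -tag_eqE /tag_eq /= (negbTE r_r0) /=.
  by rewrite prodr_const card_ord.
by rewrite sum_prod1.
Qed.
End Words.

(** The factor [u r] meets [u' r] at the start of the next factor. Only the cyclic seam survives:
    the predecessor of 0 is the last index, so both outer terms carry [ord_max]. *)
Lemma prod_telescope (A : pzRingType) p (u u' z : 'I_p.+1 -> A) :
  (forall r, u r * u' r = 1) -> (forall r, u' r * u r = 1) ->
  \prod_(r < p.+1) (u' (ord_pred r) * z r * u r) =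
  u' ord_max * \prod_(r < p.+1) z r * u ord_max.
Proof.
move=> uu' u'u.
(* [shift w k] is [w] at the cyclic predecessor of [k], as a function on natural numbers; this
   allows an induction on partial products. *)
pose shift (w : 'I_p.+1 -> A) k := if k is k'.+1 then w (inord k') else w ord_max.
have shift_prod k : \prod_(r < k) (shift u' r * z (inord r) * shift u r.+1) =
    u' ord_max * \prod_(r < k) z (inord r) * shift u k.
  elim: k => [|k IH]; first by rewrite !big_ord0 mulr1 u'u.
  have shiftV : shift u k * shift u' k = 1 by case: k {IH} => [|k] /=; rewrite uu'.
  by rewrite big_ord_recr [in RHS]big_ord_recr /= -/shift IH -!mulrA
     (mulrA (shift u k)) shiftV mul1r.
have := shift_prod p.+1; rewrite /= (_ : inord p = ord_max); last first.
  by apply/val_inj; rewrite /= inordK.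
under [X in _ = _ * X * _]eq_bigr do rewrite inord_val.
move=> <-; apply: eq_bigr => -[[|r] r_p] _; rewrite inord_val.
  by congr (u' _ * _ * _); apply/val_inj; rewrite /= modn_small.
congr (u' _ * _ * u _); apply/val_inj => /=; rewrite inordK//.
- by rewrite modnDr modn_small// ltnW.
- exact: ltnW.
Qed.

(** The identity exp(aX) exp(bX) = exp((a + b)X) modulo X^L. *)
Lemma coef_expM (F : numFieldType) L (P Q : {poly F}) (a b : F) :
  (forall n, (n < L)%N -> P`_n = a ^+ n / n`!%:R) ->
  (forall n, (n < L)%N -> Q`_n = b ^+ n / n`!%:R) ->
  forall n, (n < L)%N -> (P * Q)`_n = (a + b) ^+ n / n`!%:R.
Proof.
move=> hP hQ n nL; rewrite coefMr exprDn mulr_suml; apply: eq_bigr => -[i /= i_n] _.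
rewrite ltnS in i_n.
rewrite hP ?hQ ?(leq_ltn_trans _ nL)// ?leq_subr//.
have fact_neq0 m : (m`!%:R : F) != 0 by rewrite pnatr_eq0 -lt0n fact_gt0.
rewrite -[n`!](bin_fact i_n) -(mulr_natr _ 'C(n, i)) !natrM.
have bin_neq0 : ('C(n, i)%:R : F) != 0 by rewrite pnatr_eq0 -lt0n bin_gt0.
by field; rewrite !fact_neq0.
Qed.

(** Both sides are the coefficient of X^n in exp(cX)^p = exp(pcX). The exponential may be truncated
    to a polynomial of degree below [L] since n < L. *)
Lemma sum_prod_exp (F : numFieldType) p L n (c : F) : (n < L)%N ->
  \sum_(f : {ffun 'I_p -> 'I_L} | (\sum_(r < p) f r == n)%N)
    \prod_(r < p) (c ^+ f r / (f r)`!%:R) = (c *+ p) ^+ n / n`!%:R.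
Proof.
move=> nL; pose P : {poly F} := \sum_(j < L) (c ^+ j / j`!%:R) *: 'X^j.
have coefP k : (k < L)%N -> P`_k = c ^+ k / k`!%:R.
  move=> kL; rewrite coef_sum (bigD1 (Ordinal kL)) //= big1 => [|j].
    by rewrite coefZ coefXn eqxx mulr1 addr0.
  by rewrite -val_eqE /= eq_sym coefZ coefXn => /negbTE ->; rewrite mulr0.
have -> : (c *+ p) ^+ n / n`!%:R = (\prod_(r < p) P)`_n.
  elim: p n nL => [|p IH] n nL.
    rewrite big_ord0 coef1 mulr0n; case: n {nL} => [|n] /=.
      by rewrite expr0 fact0 divr1.
    by rewrite expr0n mul0r.
  rewrite big_ord_recl mulrS (@coef_expM F L P _ c (c *+ p))// => k kL.
  by rewrite IH.
rewrite bigA_distr_bigA coef_sum big_mkcond /=; apply: eq_bigr => f _.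
rewrite [in RHS]scaler_prod coefZ prodrXr coefXn eq_sym.
by case: eqP; rewrite ?mulr1 ?mulr0.
Qed.

(** * Symmetry of second derivatives *)

Lemma dist_le_half (R : realFieldType) (p q s t e : R) : s = t ->
  `|p - s| < e / 2 -> `|q - t| < e / 2 -> `|p - q| <= e.
Proof.
move=> <- p_s q_s; rewrite (splitr e) ltW// -(subrK s p) -addrA.
by rewrite (le_lt_trans (ler_normD _ _))// ltrD// distrC.
Qed.

Section LineDerivative.
Variables (R : realType) (V : normedModType R).
Implicit Types (f : V -> R^o) (x y u v w : V).

Lemma derivable_line f y w (t : R) : derivable f (t *: w + y) w ->
  is_derive (t : R^o) (1 : R^o) (fun t : R^o => f (t *: w + y)) ('D_w f (t *: w + y)).
Proof.
have quotE : (fun h : R => h^-1 *: (f ((h *: (1 : R^o) + t : R^o) *: w + y) -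
     f (t *: w + y))) =
   (fun h : R => h^-1 *: (f (h *: w + (t *: w + y)) - f (t *: w + y))).
  by apply/funext => h; rewrite [h *: 1]mulr1 scalerDl addrA.
by move=> fw; split; rewrite /derivable /derive quotE.
Qed.

Lemma MVT_line f y w (r : R) : 0 < r ->
  (forall t : R, 0 <= t <= r -> derivable f (t *: w + y) w) ->
  exists2 t : R, 0 < t < r & f (r *: w + y) - f y = r * 'D_w f (t *: w + y).
Proof.
move=> r_gt0 fw.
have fD (t : R) : 0 <= t <= r -> is_derive (t : R^o) (1 : R^o)
    (fun t : R^o => f (t *: w + y)) ('D_w f (t *: w + y)).
  by move=> /fw; exact: derivable_line.
have [||t tr] := @MVT R (fun t => f (t *: w + y)) (fun t => 'D_w f (t *: w + y)) 0 r r_gt0.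
- by move=> t; rewrite in_itv /= => /andP[t0 t1]; apply: fD; rewrite !ltW.
- apply: derivable_within_continuous => t; rewrite in_itv /= => /fD tD; exact: ex_derive.
by rewrite scale0r add0r subr0 mulrC => ->; exists t; rewrite // -in_itv.
Qed.

(* The second difference is symmetric in [u] and [v], so [derive_comm] compares
   its two evaluations as [r] tends to 0. *)
Lemma second_difference f x u v (r : R) : 0 < r ->
  (forall a b : R, 0 <= a <= r -> 0 <= b <= r ->
     derivable f (a *: u + (b *: v + x)) u /\
     derivable ('D_u f) (b *: v + (a *: u + x)) v) ->
  exists a b : R, [/\ 0 < a < r, 0 < b < r &
    f (r *: u + (r *: v + x)) - f (r *: u + x) - f (r *: v + x) + f x =
    r * (r * 'D_v ('D_u f) (b *: v + (a *: u + x)))].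
Proof.
move=> r0 fuv.
have z_r : 0 <= (0 : R) <= r by rewrite lexx ltW.
have r_r : 0 <= r <= r by rewrite lexx ltW.
(* The second difference of [f] is the first difference of [g] along [u]. The mean value theorem is
   applied to [g] along [u], then to ['D_u f] along [v]. *)
pose g : V -> R^o := fun y => f (r *: v + y) - f y.
have gE y : derivable f (r *: v + y) u -> derivable f y u ->
    derivable g y u /\ 'D_u g y = 'D_u f (r *: v + y) - 'D_u f y.
  move=> f1 f2.
  have [sD sE] : derivable (fun y : V => f (r *: v + y)) y u /\
      'D_u (fun y : V => f (r *: v + y)) y = 'D_u f (r *: v + y).
    have E : (fun h : R => h^-1 *: (f (r *: v + (h *: u + y)) - f (r *: v + y))) =
             (fun h : R => h^-1 *: (f (h *: u + (r *: v + y)) - f (r *: v + y))).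
      by apply/funext => h; rewrite (addrCA (r *: v)).
    by rewrite /derivable /derive E; split; [exact: f1|reflexivity].
  split; first exact: derivableB.
  by rewrite (deriveB sD f2) sE.
have fD (a : R) : 0 <= a <= r -> 
    derivable f (r *: v + (a *: u + x)) u /\ derivable f (a *: u + x) u.
  move=> ar; split; first by rewrite (addrCA (r *: v)); exact: (fuv a r ar r_r).1.
  by have [] := fuv a 0 ar z_r; rewrite scale0r add0r.
have [|a ar gr] := @MVT_line g x u r r0.
  by move=> a /fD [f1 f2]; have [] := gE _ f1 f2.
have ar' : 0 <= a <= r by case/andP: ar => a0 a1; rewrite !ltW.
have [|b br Dr] := @MVT_line ('D_u f) (a *: u + x) v r r0.
  by move=> b br; have [] := fuv a b ar' br.
exists a, b; split => //; rewrite -Dr; have [f1 f2] := fD _ ar'.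
have [_ gD] := gE _ f1 f2; rewrite -gD -gr /g (addrCA (r *: u)).
have ringE (p q s t : R) : p - q - s + t = p - q - (s - t) by ring.
exact: ringE.
Qed.

Lemma derive_comm f x u v :
  (\forall y \near x, [/\ derivable f y u, derivable f y v,
     derivable ('D_u f) y v & derivable ('D_v f) y u]) ->
  {for x, continuous ('D_v ('D_u f))} -> {for x, continuous ('D_u ('D_v f))} ->
  'D_v ('D_u f) x = 'D_u ('D_v f) x.
Proof.
move=> fD cvu cuv; apply/eqP; rewrite -subr_eq0 -normr_le0; apply/ler_addgt0Pl => e e0.
rewrite addr0.
have e2 : 0 < e / 2 by rewrite divr_gt0.
have /nbhs_ballP[d /= d0 dP] : \forall y \near x, [/\ derivable f y u, derivable f y v,
     derivable ('D_u f) y v & derivable ('D_v f) y u] /\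
     (`|'D_v ('D_u f) x - 'D_v ('D_u f) y| < e / 2 /\
     `|'D_u ('D_v f) x - 'D_u ('D_v f) y| < e / 2).
  move/cvgrPdist_lt : cvu => /(_ _ e2) cvu; move/cvgrPdist_lt : cuv => /(_ _ e2) cuv.
  exact (filterI fD (filterI cvu cuv)).
(* Small enough for the parallelogram with sides [r *: u] and [r *: v] at [x] to lie in the ball of
   radius [d]; the summand 1 makes the inequality strict and the denominator positive. *)
pose r := d / (`|u| + `|v| + 1).
have N0 : 0 < `|u| + `|v| + 1 by rewrite ltr_wpDl// addr_ge0.
have r0 : 0 < r by rewrite divr_gt0.
have inball (a b : R) : 0 <= a <= r -> 0 <= b <= r -> ball x d (a *: u + (b *: v + x)).
  move=> /andP[a0 ar] /andP[b0 br].
  rewrite -ball_normE /= addrA opprD addrCA subrr addr0 normrN.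
  rewrite (le_lt_trans (ler_normD _ _))// !normrZ !ger0_norm//.
  have : a * `|u| + b * `|v| <= r * (`|u| + `|v|) by rewrite mulrDr lerD// ler_wpM2r.
  move=> /le_lt_trans; apply; rewrite /r mulrAC ltr_pdivrMr// ltr_pM2l// ltrDl//.
have [|a [b [ar br E1]]] := @second_difference f x u v r r0.
  move=> a b ar br; have [[f1 _ _ _] _] := dP _ (inball _ _ ar br).
  have /dP[[_ _ f2 _] _] : ball x d (b *: v + (a *: u + x)).
    by rewrite (addrCA (b *: v)); exact: inball.
  by split.
have [|b' [a' [br' ar' E2]]] := @second_difference f x v u r r0.
  move=> b2 a2 br2 ar2; have [[_ _ _ f2] _] := dP _ (inball _ _ ar2 br2).
  have /dP[[_ f1 _ _] _] : ball x d (b2 *: v + (a2 *: u + x)).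
    by rewrite (addrCA (b2 *: v)); exact: inball.
  by split.
have E : r * (r * 'D_v ('D_u f) (b *: v + (a *: u + x))) =
    r * (r * 'D_u ('D_v f) (a' *: u + (b' *: v + x))).
  have ringE (p q s t : R) : p - q - s + t = p - s - q + t by ring.
  rewrite (addrCA (r *: v)) in E2.
  exact: etrans (esym E1) (etrans (ringE _ _ _ _) E2).
have {}E := mulfI (lt0r_neq0 r0) (mulfI (lt0r_neq0 r0) E).
have wle (t : R) : 0 < t < r -> 0 <= t <= r by case/andP => t0 tr; rewrite !ltW.
have /dP[_ [n1 _]] : ball x d (b *: v + (a *: u + x)).
  by rewrite (addrCA (b *: v)); apply: inball; exact: wle.
have /dP[_ [_ n2]] := inball _ _ (wle _ ar') (wle _ br').
exact (dist_le_half E n1 n2).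
Qed.
End LineDerivative.

(** * Smooth complex functions *)

(** The first-order expansion of [f] at [x] is also one of [g], and uniqueness of the linear part
    identifies it with the differential of [g]. *)
Lemma near_eq_differentiable (R : realType) (V W : normedModType R) (f g : V -> W)
    (x : V) : {near x, f =1 g} -> differentiable f x -> differentiable g x.
Proof.
move=> fg fx; have gE : g \o shift x = cst (g x) + 'd f x +o_ 0 id.
  apply/eqaddoP => e e0; have /eqaddoP/(_ e e0) := diff_locally fx.
  have fg0 : \forall h \near (0 : V), f (h + x) = g (h + x).
    by move: fg; rewrite (near_shift 0) subr0.
  apply: filterS2 fg0 => h fgh.
  by rewrite !fctE /= fgh (nbhs_singleton fg).
have dg := diff_unique (diff_continuous fx) gE.
by apply/diff_locallyP; rewrite dg; split; first exact: diff_continuous.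
Qed.

Lemma complex_ReM (R : realType) (a b : R[i]) : complex.Re (a * b) =
  complex.Re a * complex.Re b - complex.Im a * complex.Im b.
Proof. by case: a; case: b. Qed.

Lemma complex_ImM (R : realType) (a b : R[i]) : complex.Im (a * b) =
  complex.Re a * complex.Im b + complex.Im a * complex.Re b.
Proof. by case: a; case: b. Qed.

Section SmoothOn.
Variables (R : realType) (V : normedModType R) (D : set V).
Hypothesis D_open : open D.

(* [smooth_on] differentiates along the last vector of the list first; this
   variant peels derivatives off in the same order, which makes it suitable for
   induction. *)
Fixpoint smooth_upto (W : normedModType R) (n : nat) (f : V -> W) : Prop :=
  (forall x, D x -> differentiable f x) /\
  (if n is n'.+1 then forall v, smooth_upto n' ('D_v f) else True).

Lemma smooth_onP (W : normedModType R) (f : V -> W) :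
  smooth_on D f <-> forall n, smooth_upto n f.
Proof.
split=> [fs n|fs vs].
  elim: n f fs => [|n IH] f fs; split=> //; try exact: (fs [::]).
  move=> v; apply: IH => vs x Dx.
  by have := fs (rcons vs v) x Dx; rewrite foldr_rcons.
have := fs (size vs); elim/last_ind: vs f {fs} => [|vs v IH] f; first by case.
by rewrite size_rcons foldr_rcons => -[_ /(_ v)]; exact: IH.
Qed.

(** As [D] is open, agreement on [D] is agreement near each of its points and passes to
    derivatives. *)
Lemma smooth_upto_eq (W : normedModType R) n (f g : V -> W) :
  (forall x, D x -> f x = g x) -> smooth_upto n f -> smooth_upto n g.
Proof.
have near_fg (f1 g1 : V -> W) x : (forall y, D y -> f1 y = g1 y) -> D x ->
    {near x, f1 =1 g1}.
  by move=> fg Dx; near do apply: fg; exact: open_nbhs_nbhs.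
elim: n f g => [|n IH] f g fg [f0 fS]; split=> //.
- by move=> x Dx; apply: near_eq_differentiable (f0 x Dx); exact: near_fg.
- by move=> x Dx; apply: near_eq_differentiable (f0 x Dx); exact: near_fg.
- move=> v; apply: IH (fS v) => x Dx; apply: near_eq_derive; exact: near_fg.
Unshelve. all: by end_near. Qed.

Lemma smooth_uptoS (W : normedModType R) n (f : V -> W) :
  smooth_upto n.+1 f -> smooth_upto n f.
Proof.
elim: n f => [|n IH] f [f0 fS]; split=> // v; first exact: IH.
Qed.

Lemma smooth_uptoD (W : normedModType R) n (f g : V -> W) :
  smooth_upto n f -> smooth_upto n g -> smooth_upto n (f + g).
Proof.
elim: n f g => [|n IH] f g [f0 fS] [g0 gS];
  (split; first by move=> x Dx; apply: differentiableD; [exact: f0|exact: g0]) => //.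
move=> v; apply: smooth_upto_eq (IH _ _ (fS v) (gS v)) => x Dx.
by rewrite deriveD//; apply: diff_derivable; [exact: f0|exact: g0].
Qed.

Lemma smooth_uptoN (W : normedModType R) n (f : V -> W) :
  smooth_upto n f -> smooth_upto n (- f).
Proof.
elim: n f => [|n IH] f [f0 fS];
  (split; first by move=> x Dx; apply: differentiableN; exact: f0) => //.
move=> v; apply: smooth_upto_eq (IH _ (fS v)) => x Dx.
by rewrite deriveN//; apply: diff_derivable; exact: f0.
Qed.

Lemma smooth_uptoM n (f g : V -> R^o) :
  smooth_upto n f -> smooth_upto n g -> smooth_upto n (fun x => f x * g x : R^o).
Proof.
elim: n f g => [|n IH] f g fn gn; have [f0 fS] := fn; have [g0 gS] := gn;
  (split; first by move=> x Dx; apply: differentiableM; [exact: f0|exact: g0]) => //.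
(* The product rule leaves one factor undifferentiated, which is then used to the lower order
   only. *)
move=> v; apply: smooth_upto_eq (smooth_uptoD
  (IH _ _ (smooth_uptoS fn) (gS v)) (IH _ _ (smooth_uptoS gn) (fS v))) => x Dx.
by rewrite (@deriveM _ _ f g) //; apply: diff_derivable; [exact: f0|exact: g0].
Qed.

Lemma csmooth_onP (f : V -> R[i]) : csmooth_on D f <->
  forall n, smooth_upto n (fun y => complex.Re (f y) : R^o) /\
            smooth_upto n (fun y => complex.Im (f y) : R^o).
Proof.
split=> [[/smooth_onP fr /smooth_onP fi] n|fs]; first by split.
by split; apply/smooth_onP => n; have [] := fs n.
Qed.

Lemma csmooth_on_eq (f g : V -> R[i]) :
  (forall x, D x -> f x = g x) -> csmooth_on D f -> csmooth_on D g.
Proof.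
move=> fg /csmooth_onP fs; apply/csmooth_onP => n; have [fr fi] := fs n.
split; first by apply: smooth_upto_eq fr => x /fg ->.
by apply: smooth_upto_eq fi => x /fg ->.
Qed.

Lemma csmooth_onD (f g : V -> R[i]) :
  csmooth_on D f -> csmooth_on D g -> csmooth_on D (fun x => f x + g x).
Proof.
move=> /csmooth_onP fs /csmooth_onP gs; apply/csmooth_onP => n.
have [fr fi] := fs n; have [gr gi] := gs n; split.
  by apply: smooth_upto_eq (smooth_uptoD fr gr) => x _; rewrite raddfD.
by apply: smooth_upto_eq (smooth_uptoD fi gi) => x _; rewrite raddfD.
Qed.

Lemma csmooth_onM (f g : V -> R[i]) :
  csmooth_on D f -> csmooth_on D g -> csmooth_on D (fun x => f x * g x).
Proof.
move=> /csmooth_onP fs /csmooth_onP gs; apply/csmooth_onP => n.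
have [fr fi] := fs n; have [gr gi] := gs n; split.
  apply: smooth_upto_eq (smooth_uptoD (smooth_uptoM fr gr)
    (smooth_uptoN (smooth_uptoM fi gi))) => x _.
  by rewrite complex_ReM.
apply: smooth_upto_eq (smooth_uptoD (smooth_uptoM fr gi) (smooth_uptoM fi gr)) => x _.
by rewrite complex_ImM.
Qed.

Lemma csmooth_on0 : csmooth_on D (fun=> 0).
Proof. by split; exact: smooth_on_cst. Qed.

Lemma smooth_on_derive_comm (f : V -> R^o) x u v : smooth_on D f -> D x ->
  'D_v ('D_u f) x = 'D_u ('D_v f) x.
Proof.
move=> fs Dx; apply: derive_comm.
- near=> y; have Dy : D y by near: y; exact: open_nbhs_nbhs.
  split; apply: diff_derivable; [exact: (fs [::])|exact: (fs [::])|
    exact: (fs [:: u])|exact: (fs [:: v])].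
- by apply: differentiable_continuous; exact: (fs [:: v; u]).
- by apply: differentiable_continuous; exact: (fs [:: u; v]).
Unshelve. all: by end_near. Qed.
End SmoothOn.

Section DeriveMul.
Variables (R : realType) (V : normedModType R) (x v : V) (p q r s : V -> R^o).
Hypotheses (px : differentiable p x) (qx : differentiable q x).
Hypotheses (rx : differentiable r x) (sx : differentiable s x).

Let derive_mul (f g : V -> R^o) : differentiable f x -> differentiable g x ->
  is_derive x v (fun y => f y * g y : R^o) ('D_v f x * g x + f x * 'D_v g x).
Proof.
move=> /(@diff_derivable _ _ _ _ _ v) fx /(@diff_derivable _ _ _ _ _ v) gx.
split; first exact: derivableM.
by rewrite (deriveM fx gx) addrC mulrC; congr (_ + _); rewrite mulrC.
Qed.

Lemma derive_mulB : 'D_v (fun y => p y * q y - r y * s y : R^o) x =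
  'D_v p x * q x + p x * 'D_v q x - ('D_v r x * s x + r x * 'D_v s x).
Proof.
have [pqD <-] := derive_mul px qx; have [rsD <-] := derive_mul rx sx.
exact: (deriveB pqD rsD).
Qed.

Lemma derive_mulD : 'D_v (fun y => p y * q y + r y * s y : R^o) x =
  'D_v p x * q x + p x * 'D_v q x + ('D_v r x * s x + r x * 'D_v s x).
Proof.
have [pqD <-] := derive_mul px qx; have [rsD <-] := derive_mul rx sx.
exact: (deriveD pqD rsD).
Qed.
End DeriveMul.

Section ComplexDerivative.
Variables (R : realType) (V : normedModType R).
Implicit Types (f g : V -> R[i]) (x v : V).

Definition cdifferentiable f x :=
  differentiable (fun y => complex.Re (f y) : R^o) x /\
  differentiable (fun y => complex.Im (f y) : R^o) x.

Lemma csmooth_differentiable (D : set V) f x :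
  csmooth_on D f -> D x -> cdifferentiable f x.
Proof. by move=> [fr fi] Dx; split; [exact: (fr [::])|exact: (fi [::])]. Qed.

Lemma csmooth_derive_differentiable (D : set V) f x v :
  csmooth_on D f -> D x -> cdifferentiable (cderive v f) x.
Proof. by move=> [fr fi] Dx; split; [exact: (fr [:: v])|exact: (fi [:: v])]. Qed.

Lemma csmooth_derive_comm (D : set V) f x u v : open D ->
  csmooth_on D f -> D x -> cderive v (cderive u f) x = cderive u (cderive v f) x.
Proof.
move=> oD [fr fi] Dx.
exact (f_equal2 (@Complex R) (smooth_on_derive_comm oD u v fr Dx)
  (smooth_on_derive_comm oD u v fi Dx)).
Qed.

Lemma cdifferentiable_cst (c : R[i]) x : cdifferentiable (fun=> c) x.
Proof. by split; exact: differentiable_cst. Qed.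

Lemma cdifferentiableD f g x : cdifferentiable f x -> cdifferentiable g x ->
  cdifferentiable (fun y => f y + g y) x.
Proof.
move=> [fr fi] [gr gi]; split.
- rewrite (_ : (fun _ => _) =
    (fun y => complex.Re (f y) : R^o) + (fun y => complex.Re (g y) : R^o)).
    exact: differentiableD.
  by apply/funext => y; rewrite raddfD.
- rewrite (_ : (fun _ => _) =
    (fun y => complex.Im (f y) : R^o) + (fun y => complex.Im (g y) : R^o)).
    exact: differentiableD.
  by apply/funext => y; rewrite raddfD.
Qed.

Lemma cderiveD f g x v : cdifferentiable f x -> cdifferentiable g x ->
  cderive v (fun y => f y + g y) x = cderive v f x + cderive v g x.
Proof.
move=> [fr fi] [gr gi]; apply/eqP; rewrite eq_complex /cderive /=.
rewrite (_ : (fun _ => complex.Re _) =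
    (fun y => complex.Re (f y) : R^o) + (fun y => complex.Re (g y) : R^o)); last first.
  by apply/funext => y; rewrite raddfD.
rewrite (_ : (fun _ => complex.Im _) =
    (fun y => complex.Im (f y) : R^o) + (fun y => complex.Im (g y) : R^o)); last first.
  by apply/funext => y; rewrite raddfD.
by rewrite !deriveD ?eqxx//; exact: diff_derivable.
Qed.

Lemma cdifferentiableM f g x : cdifferentiable f x -> cdifferentiable g x ->
  cdifferentiable (fun y => f y * g y) x.
Proof.
move=> [fr fi] [gr gi]; split; under eq_fun do rewrite ?complex_ReM ?complex_ImM.
- by apply: differentiableB; apply: differentiableM.
- by apply: differentiableD; apply: differentiableM.
Qed.

Lemma cderiveM f g x v : cdifferentiable f x -> cdifferentiable g x ->
  cderive v (fun y => f y * g y) x = cderive v f x * g x + f x * cderive v g x.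
Proof.
move=> [fr fi] [gr gi].
pose a y : R^o := complex.Re (f y); pose b y : R^o := complex.Im (f y).
pose c y : R^o := complex.Re (g y); pose d y : R^o := complex.Im (g y).
have -> : cderive v (fun y => f y * g y) x =
    Complex ('D_v (fun y => a y * c y - b y * d y : R^o) x)
            ('D_v (fun y => a y * d y + b y * c y : R^o) x).
  by rewrite /cderive; congr Complex; congr ('D_v _ x); apply/funext => y;
     rewrite ?complex_ReM ?complex_ImM.
rewrite (derive_mulB v fr gr fi gi) (derive_mulD v fr gi fi gr).
rewrite /cderive -/a -/b -/c -/d.
apply/eqP; rewrite eq_complex !raddfD /= !complex_ReM !complex_ImM /=.
by apply/andP; split; apply/eqP; rewrite /a /b /c /d; ring.
Qed.

Lemma near_eq_cderive f g x v : {near x, f =1 g} -> cderive v f x = cderive v g x.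
Proof.
by move=> fg; congr Complex; apply: near_eq_derive; near=> y; congr (_ _); near: y.
Unshelve. all: by end_near. Qed.

Lemma cderive_cst (c : R[i]) x v : cderive v (fun=> c) x = 0.
Proof. by rewrite /cderive !derive_cst. Qed.

Lemma cdifferentiable_sum I (r : seq I) (F : I -> V -> R[i]) x :
  (forall i, cdifferentiable (F i) x) ->
  cdifferentiable (fun y => \sum_(i <- r) F i y) x.
Proof.
move=> Fx; elim: r => [|i r IH].
  by under eq_fun do rewrite big_nil; exact: cdifferentiable_cst.
by under eq_fun do rewrite big_cons; exact: cdifferentiableD.
Qed.

Lemma cderive_sum I (r : seq I) (F : I -> V -> R[i]) x v :
  (forall i, cdifferentiable (F i) x) ->
  cderive v (fun y => \sum_(i <- r) F i y) x = \sum_(i <- r) cderive v (F i) x.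
Proof.
move=> Fx; elim: r => [|i r IH].
  by under eq_fun do rewrite big_nil; rewrite big_nil cderive_cst.
under eq_fun do rewrite big_cons; rewrite big_cons -IH cderiveD//.
exact: cdifferentiable_sum.
Qed.

End ComplexDerivative.

(** * Charts and frames *)

Section Charts.
Variables (R : realType) (n : nat) (M : manifold R n).
Local Notation C := (R[i]).
Implicit Types (U : set M) (f g : M -> C).

Lemma chart_image_open (c : chart M) U : open U -> open (coord c @` (dom c `&` U)).
Proof.
move=> oU.
have -> : coord c @` (dom c `&` U) = (coord c @` dom c) `&` (param c @^-1` U).
  apply/seteqP; split=> [y [x [cx Ux] <-]|y [[x cx <-]]].
    by split; [exists x|rewrite /preimage /= coordK].
  by rewrite /preimage /= coordK// => Ux; exists x.
rewrite openE => y [Dy Uy]; apply: filterI.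
  by apply: open_nbhs_nbhs; split=> //; exact: coord_open.
by apply: (param_continuous Dy); exact: open_nbhs_nbhs.
Qed.

Lemma near_chart (c : chart M) U x : open U -> dom c x -> U x ->
  \forall y \near coord c x, (coord c @` (dom c `&` U)) y.
Proof.
move=> oU cx Ux; apply: open_nbhs_nbhs; split; first exact: chart_image_open.
by exists x.
Qed.

Lemma smooth_fun_eq U f g : open U -> (forall x, U x -> f x = g x) ->
  smooth_fun U f -> smooth_fun U g.
Proof.
move=> oU fg fs c; apply: csmooth_on_eq (fs c); first exact: chart_image_open.
by move=> _ [x [cx Ux] <-]; rewrite coordK// fg.
Qed.

Lemma smooth_funS U U' f : U' `<=` U -> smooth_fun U f -> smooth_fun U' f.
Proof.
move=> UU fs c; have [fr fi] := fs c.
by split=> vs y [x [cx /UU Ux] <-]; [apply: fr|apply: fi]; exists x.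
Qed.

Lemma smooth_funD U f g : open U -> smooth_fun U f -> smooth_fun U g ->
  smooth_fun U (fun x => f x + g x).
Proof. by move=> oU fs gs c; apply: csmooth_onD => //; exact: chart_image_open. Qed.

Lemma smooth_funM U f g : open U -> smooth_fun U f -> smooth_fun U g ->
  smooth_fun U (fun x => f x * g x).
Proof. by move=> oU fs gs c; apply: csmooth_onM => //; exact: chart_image_open. Qed.

Lemma smooth_fun0 U : smooth_fun U (fun=> 0).
Proof. by move=> c; exact: csmooth_on0. Qed.

(** Chain rule through the transition map [tau]. The factorization holds only on the image of the
    overlap of the two charts, hence only near the point. *)
Lemma derive_chart (F : M -> R^o) (c d : chart M) (x : M) (u : 'rV[R]_n) :
  dom c x -> dom d x -> differentiable (fun y => F (param d y)) (coord d x) ->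
  'D_('D_u (fun y => coord d (param c y)) (coord c x)) (fun y => F (param d y)) (coord d x) =
  'D_u (fun y => F (param c y)) (coord c x).
Proof.
move=> cx dx Fd; set tau := fun y => coord d (param c y).
have tauD : differentiable tau (coord c x).
  by apply: (@transition_smooth _ _ _ c d [::]); exists x.
have tauE : tau (coord c x) = coord d x by rewrite /tau coordK.
have Fd' : differentiable (fun y => F (param d y)) (tau (coord c x)) by rewrite tauE.
rewrite -tauE (deriveE _ tauD) (deriveE _ Fd').
rewrite -[LHS]/(('d (fun y => F (param d y)) (tau (coord c x)) \o 'd tau (coord c x)) u).
rewrite -(diff_comp tauD Fd') -deriveE; last exact: differentiable_comp.
apply: near_eq_derive; near=> y.
have [x' [cx' dx'] <-] : (coord c @` (dom c `&` dom d)) y.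
  by near: y; apply: near_chart => //; exact: dom_open.
by rewrite /tau /= !coordK.
Unshelve. all: by end_near. Qed.

Lemma differential_chart U f (c : chart M) (x : M) (u : 'rV[R]_n) :
  smooth_fun U f -> dom c x -> U x ->
  differential f (of_chart c x u) = cderive u (fun y => f (param c y)) (coord c x).
Proof.
move=> fs cx Ux; have [fr fi] := fs (chart_at x).
have Dx : (coord (chart_at x) @` (dom (chart_at x) `&` U)) (coord (chart_at x) x).
  by exists x => //; split=> //; exact: chart_atP.
congr Complex.
- exact: (@derive_chart (fun z => complex.Re (f z)) _ _ _ u cx (chart_atP x) (fr [::] _ Dx)).
- exact: (@derive_chart (fun z => complex.Im (f z)) _ _ _ u cx (chart_atP x) (fi [::] _ Dx)).
Qed.

Lemma of_chart_id (x : M) (u : 'rV[R]_n) : of_chart (chart_at x) x u = u.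
Proof.
rewrite /of_chart -[RHS](@derive_id _ _ (coord (chart_at x) x) u).
apply: near_eq_derive; near=> y.
have [x' [cx' _] <-] : (coord (chart_at x) @` (dom (chart_at x) `&` setT)) y.
  by near: y; apply: near_chart => //; [exact: openT|exact: chart_atP].
by rewrite coordK.
Unshelve. all: by end_near. Qed.

Lemma in_chart_id (w : forall x : M, tangent x -> C) (x : M) (u : 'rV[R]_n) :
  in_chart (chart_at x) w u (coord (chart_at x) x) = w x u.
Proof.
rewrite -[LHS]/((fun z => w z (of_chart (chart_at x) z u))
  (param (chart_at x) (coord (chart_at x) x))).
by rewrite coordK ?of_chart_id//; exact: chart_atP.
Qed.

End Charts.

Section Bundle.
Variables (R : realType) (n : nat) (M : manifold R n) (N : nat).
Variable E : vbundle M N.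
Local Notation C := (R[i]).
Implicit Types (i j : triv E) (x : M).

Lemma tmap0 i x : tdom i x -> tmap i (0 : E x) = 0.
Proof.
by move=> /(@tmap_linear _ _ _ _ E i x) /(_ (-1) 0 0);
  rewrite scaler0 addr0 scaleN1r addNr.
Qed.

Lemma tmapD i x (s t : E x) : tdom i x -> tmap i (s + t) = tmap i s + tmap i t.
Proof. by move=> /(@tmap_linear _ _ _ _ E i x) /(_ 1 s t); rewrite !scale1r. Qed.

Lemma tmapZ i x (k : C) (s : E x) : tdom i x -> tmap i (k *: s) = k *: tmap i s.
Proof.
move=> ix; have := @tmap_linear _ _ _ _ E i x ix k s 0.
by rewrite addr0 tmap0// addr0.
Qed.

Lemma tmap_sum i x I (r : seq I) (s : I -> E x) : tdom i x ->
  tmap i (\sum_(k <- r) s k) = \sum_(k <- r) tmap i (s k).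
Proof.
move=> ix; elim: r => [|k r IH]; first by rewrite !big_nil tmap0.
by rewrite !big_cons tmapD// IH.
Qed.

Lemma tmap_inj i x : tdom i x -> injective (@tmap _ _ _ _ E i x).
Proof. by move=> ix; exact: can_inj (tmapK ix). Qed.

(** Linearity is postulated for [tmap] only; it passes to the inverse through injectivity. *)
Lemma tinv_sum_frame i x (w : 'cV[C]_N) : tdom i x ->
  tinv i x w = \sum_b w b 0 *: frame i b x.
Proof.
move=> ix; apply: (tmap_inj ix); rewrite tinvK// tmap_sum//.
under eq_bigr do rewrite tmapZ// /frame tinvK//.
apply/matrixP => a b; rewrite summxE (bigD1 a) //= big1 => [|k k_a].
  by rewrite !mxE !ord1 !eqxx mulr1 addr0.
by rewrite !mxE (eq_sym a) (negbTE k_a) mulr0.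
Qed.

Lemma tmap_tinv i j x (w : 'cV[C]_N) : tdom i x -> tdom j x ->
  tmap i (tinv j x w) = gtrans i j x *m w.
Proof.
move=> ix jx; rewrite tinv_sum_frame// tmap_sum//; apply/matrixP => a z.
rewrite summxE mxE; apply: eq_bigr => b _.
by rewrite tmapZ// !mxE !ord1 mulrC.
Qed.

Lemma gtrans_mul i j k x : tdom i x -> tdom j x -> tdom k x ->
  gtrans i j x *m gtrans j k x = gtrans i k x.
Proof.
move=> ix jx kx; apply/matrixP => a b.
rewrite [RHS]mxE -[tinv k x _](tmapK jx) tmap_tinv// !mxE.
by apply: eq_bigr => d _; congr (_ * _); rewrite mxE.
Qed.

Lemma gtrans_id i x : tdom i x -> gtrans i i x = 1%:M.
Proof. by move=> ix; apply/matrixP => a b; rewrite !mxE tinvK// !mxE eqxx andbT. Qed.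

Lemma frame_gtrans i j b x : tdom i x -> tdom j x ->
  frame j b x = \sum_a gtrans i j x a b *: frame i a x.
Proof.
move=> ix jx; rewrite -[LHS](tmapK ix) tinv_sum_frame//.
by apply: eq_bigr => a _; rewrite mxE.
Qed.

Lemma smooth_gtrans i j a b :
  smooth_fun (tdom i `&` tdom j) (fun x => gtrans i j x a b).
Proof.
by move=> c; under eq_fun do rewrite mxE; exact: gtrans_smooth.
Qed.

Lemma smooth_frame i b : smooth_section (tdom i) (@frame _ _ _ _ E i b).
Proof. by move=> j a; exact: gtrans_smooth. Qed.

Lemma smooth_sectionS (U U' : set M) (s : forall x, E x) : U' `<=` U ->
  smooth_section U s -> smooth_section U' s.
Proof. by move=> UU ss i a; apply: smooth_funS (ss i a); exact: setIS. Qed.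

Lemma smooth_sectionZD (U : set M) (f : M -> C) (s t : forall x, E x) : open U ->
  smooth_fun U f -> smooth_section U s -> smooth_section U t ->
  smooth_section U (fun x => f x *: s x + t x).
Proof.
move=> oU fs ss ts i a.
have oiU : open (tdom i `&` U) by apply: openI => //; exact: tdom_open.
have fs' : smooth_fun (tdom i `&` U) f by apply: smooth_funS fs => x [].
have E1 x : (tdom i `&` U) x ->
    f x * tmap i (s x) a 0 + tmap i (t x) a 0 = tmap i (f x *: s x + t x) a 0.
  move=> [ix Ux]; rewrite (tmapD _ _ ix) (tmapZ _ _ ix).
  by rewrite [RHS]mxE [in RHS]mxE.
exact: (smooth_fun_eq oiU E1 (smooth_funD oiU (smooth_funM oiU fs' (ss i a)) (ts i a))).
Qed.

Lemma smooth_section0 (U : set M) : open U -> smooth_section U (fun x => 0 : E x).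
Proof.
move=> oU i a; apply: smooth_fun_eq (@smooth_fun0 _ _ M _).
  by apply: openI => //; exact: tdom_open.
by move=> x [ix _]; rewrite tmap0// mxE.
Qed.

End Bundle.

(** * Change of frame *)

Section MatrixDerivative.
Variables (R : realType) (V : normedModType R) (N : nat).
Local Notation C := (R[i]).
Implicit Types (F G : V -> 'M[C]_N) (x v : V).

Definition mxderive v F x : 'M[C]_N := \matrix_(a, b) cderive v (fun y => F y a b) x.

Definition mxdifferentiable F x := forall a b, cdifferentiable (fun y => F y a b) x.

Lemma mxderiveE v F x a b : mxderive v F x a b = cderive v (fun y => F y a b) x.
Proof. by rewrite /mxderive mxE. Qed.

Lemma mxdifferentiableM F G x : mxdifferentiable F x -> mxdifferentiable G x ->
  mxdifferentiable (fun y => F y *m G y) x.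
Proof.
move=> Fx Gx a b; under eq_fun do rewrite mxE.
by apply: cdifferentiable_sum => k; exact: cdifferentiableM.
Qed.

Lemma mxderiveM F G x v : mxdifferentiable F x -> mxdifferentiable G x ->
  mxderive v (fun y => F y *m G y) x = mxderive v F x *m G x + F x *m mxderive v G x.
Proof.
move=> Fx Gx; apply/matrixP => a b; rewrite !mxE; under eq_fun do rewrite mxE.
rewrite cderive_sum => [|k]; last exact: cdifferentiableM.
by rewrite -big_split; apply: eq_bigr => k _; rewrite cderiveM// !mxE.
Qed.

Lemma mxderiveD F G x v : mxdifferentiable F x -> mxdifferentiable G x ->
  mxderive v (fun y => F y + G y) x = mxderive v F x + mxderive v G x.
Proof.
move=> Fx Gx; apply/matrixP => a b; rewrite !mxE; under eq_fun do rewrite mxE.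
by rewrite cderiveD.
Qed.

Lemma mxderive_cst (A : 'M[C]_N) x v : mxderive v (fun=> A) x = 0.
Proof. by apply/matrixP => a b; rewrite !mxE cderive_cst. Qed.

Lemma mxdifferentiable_cst (A : 'M[C]_N) x : mxdifferentiable (fun=> A) x.
Proof. by move=> a b; exact: cdifferentiable_cst. Qed.

Lemma near_eq_mxderive F G x v : {near x, F =1 G} -> mxderive v F x = mxderive v G x.
Proof.
move=> FG; apply/matrixP => a b; rewrite !mxE; apply: near_eq_cderive.
by apply: filterS FG => y ->.
Qed.

Lemma mxderive_comm (D : set V) F x u v : open D ->
  (forall a b, csmooth_on D (fun y => F y a b)) -> D x ->
  mxderive v (mxderive u F) x = mxderive u (mxderive v F) x.
Proof.
move=> oD Fs Dx; apply/matrixP => a b.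
have entryE w : (fun y => mxderive w F y a b) = cderive w (fun y => F y a b).
  by apply/funext => y; exact: mxderiveE.
have deriveE w w' : mxderive w (mxderive w' F) x a b =
    cderive w (cderive w' (fun y => F y a b)) x.
  exact (etrans (mxderiveE w (mxderive w' F) x a b)
    (f_equal (fun f => cderive w f x) (entryE w'))).
exact (etrans (deriveE v u) (etrans (csmooth_derive_comm u v oD (Fs a b) Dx)
  (esym (deriveE u v)))).
Qed.

(* Here [p], [q] are the derivatives of the transition matrix [h] in two
   directions, and the hypotheses are the transformation law of the connection
   matrices and its derivatives. *)
Lemma gauge_algebra (h p q d Av Aw Bv Bw DAvw DAwv DBvw DBwv : 'M[C]_N) :
  h *m Bw = q + Aw *m h -> h *m Bv = p + Av *m h ->
  q *m Bv + h *m DBwv = d + (DAwv *m h + Av *m q) ->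
  p *m Bw + h *m DBvw = d + (DAvw *m h + Aw *m p) ->
  h *m (DBvw - DBwv + (Bv *m Bw - Bw *m Bv)) =
  (DAvw - DAwv + (Av *m Aw - Aw *m Av)) *m h.
Proof.
move=> hBw hBv E1 E2.
have {}hBw : q = h *m Bw - Aw *m h by rewrite hBw addrK.
have {}hBv : p = h *m Bv - Av *m h by rewrite hBv addrK.
move: E1 E2; rewrite {}hBw {}hBv !mulmxDr !mulmxDl !mulmxN !mulNmx.
rewrite !mulmxA => E1 E2.
apply/matrixP => a b.
have /matrixP/(_ a b) := E1; have /matrixP/(_ a b) := E2; clear E1 E2.
(* Each matrix product is made opaque before entries are taken. The identity is linear in these
   products, so it holds entry by entry and scalar [ring] decides it. *)
move: (h *m Bw *m Bv) (h *m Bv *m Bw) (Aw *m h *m Bv) (Av *m h *m Bw) => X1 X2 X3 X4.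
move: (Av *m Aw *m h) (Aw *m Av *m h) (h *m DBvw) (h *m DBwv) => X5 X6 X7 X8.
move: (DAvw *m h) (DAwv *m h) => X9 X10.
rewrite !mxE => E2 E1.
move: (X1 a b) (X2 a b) (X3 a b) (X4 a b) (X5 a b) (X6 a b) (X7 a b)
  (X8 a b) (X9 a b) (X10 a b) (d a b) E1 E2.
clear => x1 x2 x3 x4 x5 x6 x7 x8 x9 x10 x11 E1 E2.
have -> : x7 = x11 + (x9 + (x3 - x6)) - (x2 - x4) by rewrite -E2; ring.
have -> : x8 = x11 + (x10 + (x4 - x5)) - (x1 - x3) by rewrite -E1; ring.
by ring.
Qed.
End MatrixDerivative.

Section Gauge.
Variables (R : realType) (n : nat) (M : manifold R n) (N : nat).
Variable E : vbundle M N.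
Local Notation C := (R[i]).
Implicit Types (nabla : connection E) (i j : triv E) (x : M).

Lemma cov_v0 nabla (U : set M) s x : open U -> smooth_section U s -> U x ->
  cov nabla s (0 : tangent x) = 0.
Proof.
move=> oU ss Ux; have := cov_linear nabla oU ss (-1) (0 : tangent x) 0 Ux.
by rewrite scaler0 addr0 raddfN /= scaleN1r addNr.
Qed.

Lemma conn_mx0 nabla i x : tdom i x -> conn_mx nabla i (0 : tangent x) = 0.
Proof.
move=> ix; apply/matrixP => a b; rewrite !mxE.
by rewrite (cov_v0 nabla (tdom_open i) (smooth_frame i b) ix) tmap0// mxE.
Qed.

Lemma cov_sum nabla (U : set M) I (r : seq I) (f : I -> M -> C)
    (s : I -> forall x, E x) x (v : tangent x) :
  open U -> (forall k, smooth_fun U (f k)) -> (forall k, smooth_section U (s k)) ->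
  U x ->
  cov nabla (fun y => \sum_(k <- r) f k y *: s k y) v =
  \sum_(k <- r) (differential (f k) v *: s k x + f k x *: cov nabla (s k) v).
Proof.
move=> oU fs ss Ux.
have zs : smooth_section U (fun x => 0 : E x) by exact: smooth_section0.
have scaled k : smooth_section U (fun y => f k y *: s k y).
  rewrite (_ : (fun y => _) = (fun y => f k y *: s k y + 0)).
    exact: smooth_sectionZD.
  by apply: functional_extensionality_dep => y; rewrite addr0.
have nilE : (fun y => \sum_(k <- [::]) f k y *: s k y) = (fun y => 0 : E y).
  by apply: functional_extensionality_dep => y; rewrite big_nil.
have consE k r' : (fun y => \sum_(k <- k :: r') f k y *: s k y) =
    (fun y => f k y *: s k y + \sum_(k <- r') f k y *: s k y).
  by apply: functional_extensionality_dep => y; rewrite big_cons.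
have sums r' : smooth_section U (fun y => \sum_(k <- r') f k y *: s k y).
  elim: r' => [|k r' IH]; first by rewrite nilE.
  by rewrite consE; exact: smooth_sectionZD.
elim: r => [|k r IH].
  (* Additivity applied to 0 + 0 = 0 forces the covariant derivative of the zero section to
     vanish. *)
  rewrite big_nil nilE; have := cov_add nabla oU zs zs v Ux.
  rewrite (_ : (fun y => 0 + 0) = (fun y => 0 : E y)).
    by move=> /eqP; rewrite -subr_eq0 opprD addNKr oppr_eq0 => /eqP.
  by apply: functional_extensionality_dep => y; rewrite addr0.
rewrite consE big_cons (cov_add nabla oU (scaled k) (sums r) v Ux) IH.
by rewrite (cov_leibniz nabla oU (fs k) (ss k)).
Qed.

Definition gtrans_diff i j x (v : tangent x) : 'M[C]_N :=
  \matrix_(a, b) differential (fun y => gtrans i j y a b) v.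

(** Both sides are the components in the frame [i] of the covariant derivative of the [b]-th vector
    of the frame [j], the right one after expansion in the frame [i] and the Leibniz rule.
    Multiplying by g on the left keeps the law free of inverses. *)
Lemma gauge_conn nabla i j x (v : tangent x) : tdom i x -> tdom j x ->
  gtrans i j x *m conn_mx nabla j v =
  gtrans_diff i j v + conn_mx nabla i v *m gtrans i j x.
Proof.
move=> ix jx; pose U := tdom i `&` tdom j.
have oU : open U by apply: openI; exact: tdom_open.
have Ux : U x by split.
apply/matrixP => a b.
transitivity (tmap i (cov nabla (frame j b) v) a 0).
  rewrite -[cov nabla _ v](tmapK jx) tmap_tinv// !mxE.
  by apply: eq_bigr => d _; congr (_ * _); rewrite mxE.
have fs k : smooth_fun U (fun y => gtrans i j y k b) by exact: smooth_gtrans.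
have ss k : smooth_section U (frame i k).
  by apply: smooth_sectionS (smooth_frame i k) => y [].
have frameE y : U y -> frame j b y = \sum_k gtrans i j y k b *: frame i k y.
  by move=> [iy jy]; exact: frame_gtrans.
have sj : smooth_section U (frame j b).
  by apply: smooth_sectionS (smooth_frame j b) => y [].
have ssum : smooth_section U (fun y => \sum_k gtrans i j y k b *: frame i k y).
  move=> k c; apply: smooth_fun_eq (sj k c).
    by apply: openI => //; exact: tdom_open.
  by move=> y [_ /frameE ->].
(* The two total sections agree on the overlap [U] only, so locality is needed to exchange them. *)
rewrite (cov_local nabla oU sj ssum frameE v Ux).
rewrite (cov_sum nabla _ v oU fs ss Ux) tmap_sum// summxE !mxE.
under eq_bigr do rewrite tmapD// !tmapZ// !mxE.
rewrite big_split /=; congr (_ + _).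
  rewrite (bigD1 a) //= big1 ?addr0 => [|k k_a].
    by rewrite /frame tinvK// !mxE !eqxx mulr1.
  by rewrite /frame tinvK// !mxE eq_sym (negbTE k_a) mulr0.
by apply: eq_bigr => k _; rewrite mulrC; congr (_ * _); rewrite mxE.
Qed.

Lemma conn_smooth nabla i a b :
  smooth_form1 (tdom i) (fun x (v : tangent x) => conn_mx nabla i v a b).
Proof.
move=> c u; have := cov_smooth nabla (tdom_open i) (smooth_frame i b) i a c u.
rewrite setIid; apply: csmooth_on_eq; first exact/chart_image_open/tdom_open.
by move=> y _; rewrite /in_chart mxE.
Qed.

Definition conn_chart nabla i (c : chart M) (u y : 'rV[R]_n) : 'M[C]_N :=
  \matrix_(a, b) in_chart c (fun x v => conn_mx nabla i v a b) u y.

Lemma conn_chartE nabla i c u y :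
  conn_chart nabla i c u y = conn_mx nabla i (of_chart c (param c y) u).
Proof. by apply/matrixP => a b; rewrite mxE. Qed.

Lemma conn_chart_id nabla i x (v : tangent x) :
  conn_chart nabla i (chart_at x) v (coord (chart_at x) x) = conn_mx nabla i v.
Proof. by apply/matrixP => a b; rewrite mxE in_chart_id. Qed.

Lemma conn_chart_differentiable nabla i x c u : tdom i x -> dom c x ->
  mxdifferentiable (conn_chart nabla i c u) (coord c x).
Proof.
move=> ix cx a b; under eq_fun do rewrite mxE.
by apply: csmooth_differentiable (conn_smooth nabla i a b c u) _; exists x.
Qed.

Lemma gauge_conn_chart nabla i j x c u : tdom i x -> tdom j x -> dom c x ->
  gtrans i j x *m conn_chart nabla j c u (coord c x) =
  mxderive u (fun y => gtrans i j (param c y)) (coord c x) +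
  conn_chart nabla i c u (coord c x) *m gtrans i j x.
Proof.
move=> ix jx cx; rewrite !conn_chartE coordK// gauge_conn//; congr (_ + _).
apply/matrixP => a b; rewrite !mxE.
by rewrite (differential_chart _ (@smooth_gtrans _ _ _ _ E i j a b)).
Qed.

Definition conn_ext nabla i x (v w : tangent x) : 'M[C]_N :=
  \matrix_(a, b) ext_derivative (fun y u => conn_mx nabla i u a b) v w.

Lemma conn_extE nabla i x (v w : tangent x) :
  conn_ext nabla i v w =
  mxderive v (conn_chart nabla i (chart_at x) w) (coord (chart_at x) x) -
  mxderive w (conn_chart nabla i (chart_at x) v) (coord (chart_at x) x).
Proof.
apply/matrixP => a b.
have entryE u : (fun y => conn_chart nabla i (chart_at x) u y a b) =
    in_chart (chart_at x) (fun y u => conn_mx nabla i u a b) u.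
  by apply/funext => y; rewrite mxE.
by rewrite mxE [RHS]mxE [in RHS]mxE !mxE !entryE.
Qed.

(** The chart form of the gauge law in the direction [w] holds near [x], hence may be differentiated
    along [v]. *)
Lemma gauge_conn_derive nabla i j x (v w : tangent x) : tdom i x -> tdom j x ->
  let H y := gtrans i j (param (chart_at x) y) in
  let y0 := coord (chart_at x) x in
  mxderive v H y0 *m conn_mx nabla j w +
    gtrans i j x *m mxderive v (conn_chart nabla j (chart_at x) w) y0 =
  mxderive v (mxderive w H) y0 +
  (mxderive v (conn_chart nabla i (chart_at x) w) y0 *m gtrans i j x +
   conn_mx nabla i w *m mxderive v H y0).
Proof.
move=> ix jx H y0; set c := chart_at x; have cx : dom c x := chart_atP x.
have oij : open (tdom i `&` tdom j) by apply: openI; exact: tdom_open.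
have Hy0 : H y0 = gtrans i j x by rewrite /H coordK.
have y0D : (coord c @` (dom c `&` (tdom i `&` tdom j))) y0 by exists x.
have Hs a b := @smooth_gtrans _ _ _ _ E i j a b c.
have HD : mxdifferentiable H y0 by move=> a b; exact: csmooth_differentiable (Hs a b) y0D.
have dHD : mxdifferentiable (mxderive w H) y0.
  move=> a b; under eq_fun do rewrite mxE.
  exact: csmooth_derive_differentiable (Hs a b) y0D.
have BD k : tdom k x -> mxdifferentiable (conn_chart nabla k c w) y0.
  by move=> kx; exact: conn_chart_differentiable.
have := @near_eq_mxderive R _ N (fun y => H y *m conn_chart nabla j c w y)
  (fun y => mxderive w H y + conn_chart nabla i c w y *m H y) y0 v.
have BDi := BD _ ix; have BDj := BD _ jx.
rewrite (mxderiveM v HD BDj) (mxderiveD v dHD (mxdifferentiableM BDi HD)) (mxderiveM v BDi HD).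
rewrite Hy0 !conn_chart_id; apply; near=> y.
have [x' [cx' [ix' jx']] <-] : (coord c @` (dom c `&` (tdom i `&` tdom j))) y.
  by near: y; exact: near_chart.
by rewrite /H coordK//; exact: gauge_conn_chart.
Unshelve. all: by end_near. Qed.

(** This is d(dg) = 0: the second derivatives of g cancel when the differentiated gauge law is
    antisymmetrized. *)
Lemma gtrans_derive_comm i j x (v w : tangent x) : tdom i x -> tdom j x ->
  let H y := gtrans i j (param (chart_at x) y) in
  let y0 := coord (chart_at x) x in
  mxderive v (mxderive w H) y0 = mxderive w (mxderive v H) y0.
Proof.
move=> ix jx H y0.
have oD : open (coord (chart_at x) @` (dom (chart_at x) `&` (tdom i `&` tdom j))).
  by apply: chart_image_open; apply: openI; exact: tdom_open.
apply: (mxderive_comm w v oD); last by exists x => //; split => //; exact: chart_atP.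
by move=> a b; exact: smooth_gtrans.
Qed.

Lemma gauge_curvature_mx nabla i j x (v w : tangent x) : tdom i x -> tdom j x ->
  gtrans i j x *m (conn_ext nabla j v w + (conn_mx nabla j v *m conn_mx nabla j w -
    conn_mx nabla j w *m conn_mx nabla j v)) =
  (conn_ext nabla i v w + (conn_mx nabla i v *m conn_mx nabla i w -
    conn_mx nabla i w *m conn_mx nabla i v)) *m gtrans i j x.
Proof.
move=> ix jx; rewrite !conn_extE.
have := gauge_conn_derive nabla v w ix jx; have := gauge_conn_derive nabla w v ix jx.
have := gtrans_derive_comm v w ix jx => /= ->.
have := gauge_conn_chart nabla v ix jx (chart_atP x).
have := gauge_conn_chart nabla w ix jx (chart_atP x).
rewrite !conn_chart_id.
apply: gauge_algebra.
Qed.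

End Gauge.

(** * Smooth paths of connections *)

Section LowDegreeForms.
Variables (R : realType) (V : Type) (N : nat).
Local Notation C := (R[i]).

Lemma homogeneous_form1 (f : V -> 'M[C]_N) : homogeneous 1 (form1 f).
Proof. by case=> [|v [|w vs]]. Qed.

Lemma homogeneous_form2 (f : V -> V -> 'M[C]_N) : homogeneous 2 (form2 f).
Proof. by case=> [|v [|w [|u vs]]]. Qed.

Lemma wedge_form1 (f g : V -> 'M[C]_N) v w :
  wedge (form1 f) (form1 g) [:: v; w] = f v *m g w - f w *m g v.
Proof.
rewrite wedge_cons.
have interior_product1 (h : V -> 'M[C]_N) : interior_product v (form1 h) = form0 (h v).
  by apply/funext => -[|? ?].
rewrite !interior_product1 wedge_form0l wedge_form0r /grading /= expr1 scaleN1r.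
by rewrite mulNmx.
Qed.
End LowDegreeForms.

(** * Partial derivatives of functions of a parameter and a point *)

Section Slices.
Variables (R : realType) (W : normedModType R).
Local Notation C := (R[i]).

Lemma slice_differentiable (F : (R^o * W)%type -> C) s y :
  cdifferentiable F (s, y) -> cdifferentiable (fun s' : R^o => F (s', y)) s.
Proof.
have pairD : differentiable (fun s' : R^o => (s', y) : (R^o * W)%type) s.
  by apply: differentiable_pair; [exact: ex_diff|exact: differentiable_cst].
by move=> [Fr Fi]; split;
  [exact: (differentiable_comp pairD Fr)|exact: (differentiable_comp pairD Fi)].
Qed.

(** The difference quotients coincide. A partial derivative thus becomes a directional derivative of
    the jointly smooth function, and can be differentiated again in the other variable. *)
Lemma slice_derive1_real (G : (R^o * W)%type -> R^o) (s : R^o) y :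
  'D_(1 : R^o) (fun s' : R^o => G (s', y)) s = 'D_((1, 0) : (R^o * W)%type) G (s, y).
Proof.
have E : (fun h : R => h^-1 *: (G (h *: (1 : R^o) + s, y) - G (s, y))) =
    (fun h : R => h^-1 *: (G (h *: ((1, 0) : (R^o * W)%type) + (s, y)) - G (s, y))).
  apply/funext => h; congr (_ *: (G _ - _)).
  by rewrite -[RHS]/(h *: (1 : R^o) + s, h *: 0 + y) scaler0 add0r.
exact (f_equal (fun q : R -> R^o => lim (q @ 0^')) E).
Qed.

Lemma slice_derive2_real (G : (R^o * W)%type -> R^o) (s : R^o) y (u : W) :
  'D_u (fun y' => G (s, y')) y = 'D_((0, u) : (R^o * W)%type) G (s, y).
Proof.
have E : (fun h : R => h^-1 *: (G (s, h *: u + y) - G (s, y))) =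
    (fun h : R => h^-1 *: (G (h *: ((0, u) : (R^o * W)%type) + (s, y)) - G (s, y))).
  apply/funext => h; congr (_ *: (G _ - _)).
  by rewrite -[RHS]/(h *: (0 : R^o) + s, h *: u + y) scaler0 add0r.
exact (f_equal (fun q : R -> R^o => lim (q @ 0^')) E).
Qed.

Lemma slice_derive1 (F : (R^o * W)%type -> C) (s : R^o) y :
  cderive (1 : R^o) (fun s' : R^o => F (s', y)) s =
  cderive ((1, 0) : (R^o * W)%type) F (s, y).
Proof.
exact (f_equal2 (@Complex R)
  (slice_derive1_real (fun z => complex.Re (F z)) s y)
  (slice_derive1_real (fun z => complex.Im (F z)) s y)).
Qed.

Lemma slice_derive2 (F : (R^o * W)%type -> C) (s : R^o) y (u : W) :
  cderive u (fun y' => F (s, y')) y = cderive ((0, u) : (R^o * W)%type) F (s, y).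
Proof.
exact (f_equal2 (@Complex R)
  (slice_derive2_real (fun z => complex.Re (F z)) s y u)
  (slice_derive2_real (fun z => complex.Im (F z)) s y u)).
Qed.
End Slices.

Section GaugeForms.
Variables (R : realType) (n : nat) (M : manifold R n) (N : nat).
Variable E : vbundle M N.
Local Notation C := (R[i]).
Implicit Types (nabla : connection E) (i j : triv E) (x : M).

Lemma homogeneous_curvature nabla i x : homogeneous 2 (@curvature _ _ _ _ E nabla i x).
Proof.
move=> vs vs2; rewrite /curvature /form_add homogeneous_form2// add0r.
have h11 := homogeneousM (@homogeneous_form1 R (tangent x) N (@conn_mx _ _ _ _ E nabla i x))
  (@homogeneous_form1 R (tangent x) N (@conn_mx _ _ _ _ E nabla i x)).
exact: h11.
Qed.

Lemma curvature2 nabla i x (v w : tangent x) :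
  curvature nabla i [:: v; w] =
  conn_ext nabla i v w + (conn_mx nabla i v *m conn_mx nabla i w -
    conn_mx nabla i w *m conn_mx nabla i v).
Proof. by rewrite /curvature /form_add wedge_form1. Qed.

Lemma gauge_curvature nabla i j x : tdom i x -> tdom j x ->
  form0 (gtrans i j x) * (curvature nabla j (x := x)) =
  (curvature nabla i (x := x) : mxform R (tangent x) N) * form0 (gtrans i j x).
Proof.
move=> ix jx; apply/funext => vs; rewrite -!wedgeE wedge_form0l wedge_form0r.
have [/eqP|vs2] := eqVneq (size vs) 2%N; last first.
  by rewrite !homogeneous_curvature// mulmx0 mul0mx.
case: vs => [|v [|w [|u vs]]]//= _.
by rewrite !curvature2; exact: gauge_curvature_mx.
Qed.

Lemma conn_derivativeE (nabla : R -> connection E) s i x :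
  conn_derivative nabla s i (x := x) =
  form1 (fun v => mxderive (1 : R^o) (fun s' : R^o => conn_mx (nabla s') i v) (s : R^o)).
Proof. by []. Qed.

Section SmoothPath.
Variables (D : R -> connection E) (D_smooth : smooth_path D).

Let path_entry i (c : chart M) a b (u : 'rV[R]_n) (z : (R^o * 'rV[R]_n)%type) : C :=
  in_chart c (fun x (v : tangent x) => conn_mx (D z.1) i v a b) u z.2.

Let slab i x : set (R^o * 'rV[R]_n)%type :=
  [set z | (coord (chart_at x) @` (dom (chart_at x) `&` tdom i)) z.2].

Let slabP i x s : tdom i x -> slab i x (s, coord (chart_at x) x).
Proof. by move=> ix; exists x => //; split=> //; exact: chart_atP. Qed.

Let path_entryE i x a b (v : tangent x) :
  (fun s : R^o => path_entry i (chart_at x) a b v (s, coord (chart_at x) x)) =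
  (fun s : R^o => conn_mx (D s) i v a b).
Proof. by apply/funext => s; exact: in_chart_id. Qed.

Lemma path_conn_differentiable i x (v : tangent x) s : tdom i x ->
  mxdifferentiable (fun s : R^o => conn_mx (D s) i v) (s : R^o).
Proof.
move=> ix a b; rewrite -path_entryE; apply: slice_differentiable.
exact: csmooth_differentiable (D_smooth i (chart_at x) a b v) (slabP s ix).
Qed.

Lemma path_conn_derive_differentiable i x (v : tangent x) s : tdom i x ->
  mxdifferentiable (mxderive (1 : R^o) (fun s : R^o => conn_mx (D s) i v)) (s : R^o).
Proof.
move=> ix a b; pose F := path_entry i (chart_at x) a b v.
have -> : (fun s : R^o => mxderive (1 : R^o) (fun s : R^o => conn_mx (D s) i v) s a b) =
    (fun s : R^o => cderive ((1, 0) : (R^o * 'rV[R]_n)%type) F (s, coord (chart_at x) x)).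
  by apply/funext => s'; rewrite mxderiveE -path_entryE; exact: slice_derive1.
apply: slice_differentiable.
exact: csmooth_derive_differentiable (D_smooth i (chart_at x) a b v) (slabP s ix).
Qed.

(** The exterior derivative differentiates along M, so its regularity in s comes from smoothness in
    the pair of parameter and point. *)
Lemma path_conn_ext_differentiable i x (v w : tangent x) s : tdom i x ->
  mxdifferentiable (fun s : R^o => conn_ext (D s) i v w) (s : R^o).
Proof.
move=> ix a b; pose F u := path_entry i (chart_at x) a b u.
pose y0 := coord (chart_at x) x.
pose G u u' (s : R^o) := cderive ((0, u) : (R^o * 'rV[R]_n)%type) (F u') (s, y0).
have -> : (fun s : R^o => conn_ext (D s) i v w a b) = (fun s : R^o => G v w s + (-1) * G w v s).
  apply/funext => s'; rewrite mxE mulN1r.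
  exact (f_equal2 (fun p q : C => p - q) (slice_derive2 (F w) s' y0 v)
    (slice_derive2 (F v) s' y0 w)).
have Gs u u' : cdifferentiable (G u u') (s : R^o).
  apply: slice_differentiable.
  exact: csmooth_derive_differentiable (D_smooth i (chart_at x) a b u') (slabP s ix).
apply: cdifferentiableD => //; apply: cdifferentiableM => //.
Qed.

(** Differentiate the gauge law in s: g and dg do not depend on s, so the inhomogeneous term drops
    out. *)
Lemma gauge_conn_derivative i j x s : tdom i x -> tdom j x ->
  form0 (gtrans i j x) * (conn_derivative D s j (x := x)) =
  (conn_derivative D s i (x := x) : mxform R (tangent x) N) * form0 (gtrans i j x).
Proof.
move=> ix jx; apply/funext => vs; rewrite -!wedgeE wedge_form0l wedge_form0r !conn_derivativeE.
case: vs => [|v [|w vs]]; rewrite /= ?mulmx0 ?mul0mx//.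
have Dj := @path_conn_differentiable j x v s jx.
have Di := @path_conn_differentiable i x v s ix.
have hD := @mxdifferentiable_cst R R^o N (gtrans i j x) s.
have hd := @mxdifferentiable_cst R R^o N (gtrans_diff i j v) s.
have lawE : (fun s' : R^o => gtrans i j x *m conn_mx (D s') j v) =
    (fun s' : R^o => gtrans_diff i j v + conn_mx (D s') i v *m gtrans i j x).
  by apply/funext => s'; exact: gauge_conn.
have := f_equal (fun F => mxderive (1 : R^o) F (s : R^o)) lawE.
rewrite (mxderiveM (1 : R^o) hD Dj) (mxderiveD (1 : R^o) hd (mxdifferentiableM Di hD)).
rewrite (mxderiveM (1 : R^o) Di hD) !mxderive_cst.
by rewrite mul0mx mulmx0 !add0r addr0.
Qed.
End SmoothPath.
End GaugeForms.

(** * Integrals of piecewise continuous functions *)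

Lemma integrable_setU d (T : measurableType d) (R : realType)
    (mu : {measure set T -> \bar R}) (A B : set T) (f : T -> \bar R) :
  measurable A -> measurable B -> [disjoint A & B] ->
  mu.-integrable A f -> mu.-integrable B f -> mu.-integrable (A `|` B) f.
Proof.
move=> mA mB AB /integrableP[mfA fA] /integrableP[mfB fB]; apply/integrableP.
have mf := (measurable_funU _ mA mB).2 (conj mfA mfB).
split=> //; rewrite ge0_integral_setU//; first by rewrite lte_add_pinfty.
exact: measurableT_comp.
Qed.

Section PiecewiseContinuous.
Variables (R : realType) (m : nat) (sigma : nat -> R).
Hypothesis sigma_lt : forall k, (k < m)%N -> sigma k < sigma k.+1.
Local Notation mu := (@lebesgue_measure R).

(** Nothing is said at the breakpoints, where a derivative in s may be meaningless. Continuity of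
    [g] on the whole line gives boundedness up to the ends of each piece. *)
Definition piecewise_continuous (f : R -> R) := forall k, (k < m)%N ->
  exists2 g : R -> R, continuous g & forall s, sigma k < s < sigma k.+1 -> f s = g s.

Lemma sigma_le k : (k <= m)%N -> sigma 0%N <= sigma k.
Proof.
elim: k => // k IH km; rewrite (le_trans (IH (ltnW km)))// ltW//; exact: sigma_lt.
Qed.

(** The interval is extended by one open piece and its right endpoint at a time: on the piece a
    continuous function is integrated, and the endpoint is a null set. *)
Lemma piecewise_integrable (f : R -> R) : piecewise_continuous f ->
  mu.-integrable `[sigma 0%N, sigma m] (EFin \o f).
Proof.
move=> fm; suff : forall k, (k <= m)%N -> mu.-integrable `[sigma 0%N, sigma k] (EFin \o f).
  by apply.
have single r : mu.-integrable [set r] (EFin \o f).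
  apply: null_set_integrable => //; first exact: measurable_fun_set1.
  exact: lebesgue_measure_set1.
elim=> [_|k IH km]; first by rewrite set_itv1.
have lek := sigma_le (ltnW km); have ltk := sigma_lt km.
have -> : `[sigma 0%N, sigma k.+1]%classic = `[sigma 0%N, sigma k]%classic `|`
    (`]sigma k, sigma k.+1[%classic `|` [set sigma k.+1]).
  apply/seteqP; split=> s /=; rewrite !in_itv /=.
    move=> /andP[s0 s1]; have [sk|ks] := leP s (sigma k); first by left; rewrite s0.
    right; have [?|s1'] := ltP s (sigma k.+1); [by left|right].
    by apply/eqP; rewrite eq_le s1.
  case=> [/andP[-> sk]|[/andP[ks /ltW ->]|->]].
  - by rewrite (le_trans sk)// ltW.
  - by rewrite (le_trans lek)// ltW.
  - by rewrite lexx andbT (le_trans lek)// ltW.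
have [g gc fg] := fm _ km.
have fpiece : mu.-integrable `]sigma k, sigma k.+1[ (EFin \o f).
  have gpiece : mu.-integrable `]sigma k, sigma k.+1[ (EFin \o g).
    have gint : mu.-integrable `[sigma k, sigma k.+1] (EFin \o g).
      apply: continuous_compact_integrable; first exact: segment_compact.
      by apply: continuous_subspaceT => s; exact: gc.
    by apply: integrableS gint => //; exact: subset_itv_oo_cc.
  apply: eq_integrable gpiece => // s.
  by rewrite inE/= in_itv/= => /fg ->.
have disj1 : [disjoint `]sigma k, sigma k.+1[%classic & [set sigma k.+1]].
  apply/disj_set2P/seteqP; split=> s //= []; rewrite in_itv /= => /andP[_ s1] sE.
  by move: s1; rewrite sE ltxx.
have disj2 : [disjoint `[sigma 0%N, sigma k]%classic &
    (`]sigma k, sigma k.+1[%classic `|` [set sigma k.+1])].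
  apply/disj_set2P/seteqP; split=> s //= []; rewrite !in_itv /= => /andP[_ sk].
  by case=> [/andP[ks _]|sE]; [move: ks|move: ltk; rewrite -sE]; rewrite ltNge sk.
have i1 := IH (ltnW km).
have i2 : mu.-integrable (`]sigma k, sigma k.+1[ `|` [set sigma k.+1]) (EFin \o f).
  by apply: integrable_setU => //; exact: single.
by apply: integrable_setU => //; exact: measurableU.
Qed.

Lemma piece_cover s k : (k <= m)%N -> sigma 0%N <= s <= sigma k ->
  (exists l, s = sigma l) \/ exists2 l, (l < m)%N & sigma l < s < sigma l.+1.
Proof.
elim: k => [_|k IH km].
  by rewrite -eq_le => /eqP <-; left; exists 0%N.
move=> /andP[s0 sk]; have [sk'|ks] := leP s (sigma k).
  by apply: (IH (ltnW km)); rewrite s0.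
have [sk1|] := ltP s (sigma k.+1); first by right; exists k; rewrite // ks.
by move=> ?; left; exists k.+1; apply/eqP; rewrite eq_le sk.
Qed.

Lemma piecewise_Rintegral_eq (f g : R -> R) :
  piecewise_continuous f -> piecewise_continuous g ->
  (forall k s, (k < m)%N -> sigma k < s < sigma k.+1 -> f s = g s) ->
  \int[mu]_(s in `[sigma 0%N, sigma m]) f s = \int[mu]_(s in `[sigma 0%N, sigma m]) g s.
Proof.
move=> fm gm fg; congr fine.
have /integrableP[mf _] := piecewise_integrable fm.
have /integrableP[mg _] := piecewise_integrable gm.
have Sc : countable (range sigma) by exact: card_image_le.
(* The whole range of [sigma] serves as exceptional set; it is countable, hence null. *)
apply: ae_eq_integral => //; exists (range sigma); split.
- exact: countable_measurable.
- exact: countable_lebesgue_measure0.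
move=> s /= /not_implyP[]; rewrite in_itv /= => sm.
have [[l ->] _|[l lm sl]] := piece_cover (leqnn m) sm; first by exists l.
by rewrite (fg l s lm sl).
Qed.

Lemma piecewise_continuousZ (c : R) (f : R -> R) : piecewise_continuous f ->
  piecewise_continuous (fun s => c * f s).
Proof.
move=> fm k /fm[g gc fg]; exists (fun s => c * g s) => [s|s sk]; last by rewrite fg.
exact: (cvgM (cvg_cst c) (gc s)).
Qed.

Definition ccontinuous (f : R -> R[i]) :=
  continuous (fun s => complex.Re (f s)) /\ continuous (fun s => complex.Im (f s)).

Lemma ccontinuous_cst (z : R[i]) : ccontinuous (fun=> z).
Proof. by split; exact: cst_continuous. Qed.

Lemma ccontinuousD f g : ccontinuous f -> ccontinuous g ->
  ccontinuous (fun s => f s + g s).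
Proof.
move=> [fr fi] [gr gi]; split => s; under eq_fun do rewrite raddfD.
- by apply: (@continuousD R R^o); [exact: fr|exact: gr].
- by apply: (@continuousD R R^o); [exact: fi|exact: gi].
Qed.

Lemma ccontinuousM f g : ccontinuous f -> ccontinuous g ->
  ccontinuous (fun s => f s * g s).
Proof.
move=> [fr fi] [gr gi]; split => s.
- under eq_fun do rewrite complex_ReM.
  exact: (cvgB (cvgM (fr s) (gr s)) (cvgM (fi s) (gi s))).
- under eq_fun do rewrite complex_ImM.
  exact: (cvgD (cvgM (fr s) (gi s)) (cvgM (fi s) (gr s))).
Qed.

Lemma ccontinuous_sum I (r : seq I) (F : I -> R -> R[i]) :
  (forall k, ccontinuous (F k)) -> ccontinuous (fun s => \sum_(k <- r) F k s).
Proof.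
move=> Fc; elim: r => [|k r IH].
  by under eq_fun do rewrite big_nil; exact: ccontinuous_cst.
by under eq_fun do rewrite big_cons; exact: ccontinuousD.
Qed.

Definition cpiecewise (f : R -> R[i]) := forall k, (k < m)%N ->
  exists2 g, ccontinuous g & forall s, sigma k < s < sigma k.+1 -> f s = g s.

Lemma cpiecewise_Re f : cpiecewise f -> piecewise_continuous (fun s => complex.Re (f s)).
Proof.
move=> fm k /fm[g [gr _] fg]; exists (fun s => complex.Re (g s)) => // s sk.
by rewrite fg.
Qed.

Lemma cpiecewise_Im f : cpiecewise f -> piecewise_continuous (fun s => complex.Im (f s)).
Proof.
move=> fm k /fm[g [_ gi] fg]; exists (fun s => complex.Im (g s)) => // s sk.
by rewrite fg.
Qed.

Lemma cpiecewiseD f g : cpiecewise f -> cpiecewise g -> cpiecewise (fun s => f s + g s).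
Proof.
move=> fm gm k km; have [f1 f1c fE] := fm k km; have [g1 g1c gE] := gm k km.
by exists (fun s => f1 s + g1 s); [exact: ccontinuousD|move=> s sk; rewrite fE// gE].
Qed.

Lemma cpiecewiseZ (z : R[i]) f : cpiecewise f -> cpiecewise (fun s => z * f s).
Proof.
move=> fm k km; have [f1 f1c fE] := fm k km; exists (fun s => z * f1 s).
  by apply: ccontinuousM => //; exact: ccontinuous_cst.
by move=> s sk; rewrite fE.
Qed.

Lemma cpiecewise0 : cpiecewise (fun=> 0).
Proof. by move=> k _; exists (fun=> 0) => //; exact: ccontinuous_cst. Qed.

Lemma cpiecewise_sum I (r : seq I) (F : I -> R -> R[i]) :
  (forall k, cpiecewise (F k)) -> cpiecewise (fun s => \sum_(k <- r) F k s).
Proof.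
move=> Fc; elim: r => [|k r IH].
  by under eq_fun do rewrite big_nil; exact: cpiecewise0.
by under eq_fun do rewrite big_cons; exact: cpiecewiseD.
Qed.

Local Notation a := (sigma 0%N).
Local Notation b := (sigma m).

Lemma cintegral_eq f g : cpiecewise f -> cpiecewise g ->
  (forall k s, (k < m)%N -> sigma k < s < sigma k.+1 -> f s = g s) ->
  cintegral a b f = cintegral a b g.
Proof.
move=> fm gm fg; congr Complex; apply: piecewise_Rintegral_eq.
- exact: cpiecewise_Re.
- exact: cpiecewise_Re.
- by move=> k s km sk; rewrite (fg k).
- exact: cpiecewise_Im.
- exact: cpiecewise_Im.
- by move=> k s km sk; rewrite (fg k).
Qed.

Lemma cintegralD f g : cpiecewise f -> cpiecewise g ->
  cintegral a b (fun s => f s + g s) = cintegral a b f + cintegral a b g.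
Proof.
move=> fm gm; rewrite /cintegral.
under eq_Rintegral do rewrite raddfD.
under [X in Complex _ X]eq_Rintegral do rewrite raddfD.
rewrite !RintegralD//; apply: piecewise_integrable;
  by [exact: cpiecewise_Re|exact: cpiecewise_Im].
Qed.

Lemma cintegralZ (z : R[i]) f : cpiecewise f ->
  cintegral a b (fun s => z * f s) = z * cintegral a b f.
Proof.
move=> fm; rewrite /cintegral.
under eq_Rintegral do rewrite complex_ReM.
under [X in Complex _ X]eq_Rintegral do rewrite complex_ImM.
have ir := piecewise_integrable (cpiecewise_Re fm).
have ii := piecewise_integrable (cpiecewise_Im fm).
have irZ := RintegralZl _ _ ir; have iiZ := RintegralZl _ _ ii.
have jrZ c := piecewise_integrable (piecewise_continuousZ c (cpiecewise_Re fm)).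
have jiZ c := piecewise_integrable (piecewise_continuousZ c (cpiecewise_Im fm)).
rewrite RintegralB// RintegralD// !irZ// !iiZ//.
by apply/eqP; rewrite eq_complex complex_ReM complex_ImM /= !eqxx.
Qed.

Lemma cintegral_sum I (r : seq I) (F : I -> R -> R[i]) :
  (forall k, cpiecewise (F k)) ->
  cintegral a b (fun s => \sum_(k <- r) F k s) = \sum_(k <- r) cintegral a b (F k).
Proof.
move=> Fm; elim: r => [|k r IH].
  rewrite big_nil; under eq_fun do rewrite big_nil.
  by rewrite -[0 in LHS](mul0r 0) cintegralZ ?mul0r//; exact: cpiecewise0.
rewrite big_cons -IH -cintegralD//; last exact: cpiecewise_sum.
by under eq_fun do rewrite big_cons.
Qed.

Section MatrixIntegral.
Variable N : nat.
Implicit Types F G : R -> 'M[R[i]]_N.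

Definition mxcontinuous F := forall i j, ccontinuous (fun s => F s i j).

Definition mxpiecewise F := forall k, (k < m)%N ->
  exists2 G, mxcontinuous G & forall s, sigma k < s < sigma k.+1 -> F s = G s.

Lemma mxpiecewise_entry F i j : mxpiecewise F -> cpiecewise (fun s => F s i j).
Proof.
move=> Fm k km; have [G Gc FG] := Fm k km.
by exists (fun s => G s i j); [exact: Gc|move=> s sk; rewrite FG].
Qed.

Lemma mxintegral_eq F G : mxpiecewise F -> mxpiecewise G ->
  (forall k s, (k < m)%N -> sigma k < s < sigma k.+1 -> F s = G s) ->
  mxintegral a b F = mxintegral a b G.
Proof.
move=> Fm Gm FG; apply/matrixP => i j; rewrite !mxE.
apply: cintegral_eq; try exact: mxpiecewise_entry.
by move=> k s km sk; rewrite (FG k).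
Qed.

Lemma mxcontinuousM F G : mxcontinuous F -> mxcontinuous G ->
  mxcontinuous (fun s => F s *m G s).
Proof.
move=> Fc Gc i j; under eq_fun do rewrite mxE.
by apply: ccontinuous_sum => k; exact: ccontinuousM.
Qed.

Lemma mxcontinuous_cst (A : 'M[R[i]]_N) : mxcontinuous (fun=> A).
Proof. by move=> i j; exact: ccontinuous_cst. Qed.

(** Each entry is a finite combination of entries of [F] with constant coefficients; [mxpiecewise]
    supplies the integrability that linearity requires. *)
Lemma mxintegral_conj F (A B : 'M[R[i]]_N) : mxpiecewise F ->
  mxintegral a b (fun s => A *m F s *m B) = A *m mxintegral a b F *m B.
Proof.
move=> Fm; apply/matrixP => i j; rewrite !mxE.
under eq_fun do rewrite mxE.
have Fe k l := mxpiecewise_entry k l Fm.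
have termE l s : (A *m F s) i l * B l j = \sum_k (A i k * B l j) * F s k l.
  by rewrite mxE mulr_suml; apply: eq_bigr => k _; rewrite mulrAC.
under eq_fun do under eq_bigr do rewrite termE.
rewrite cintegral_sum => [|l]; last first.
  by apply: cpiecewise_sum => k; exact: cpiecewiseZ.
apply: eq_bigr => l _; rewrite cintegral_sum => [|k]; last exact: cpiecewiseZ.
rewrite mxE mulr_suml; apply: eq_bigr => k _; rewrite cintegralZ// !mxE.
by rewrite mulrAC.
Qed.

Lemma trace_mxintegral_conj F (A B : 'M[R[i]]_N) : mxpiecewise F -> B *m A = 1%:M ->
  \tr (mxintegral a b (fun s => A *m F s *m B)) = \tr (mxintegral a b F).
Proof. by move=> Fm BA; rewrite mxintegral_conj// mxtrace_mulC mulmxA BA mul1mx. Qed.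

End MatrixIntegral.

End PiecewiseContinuous.

(** * Integrals over simplices *)

Section SimplexVolume.
Variable R : realType.
Local Notation mu := (@lebesgue_measure R).

(** The volume of the simplex of all t <= t_1 <= ... <= t_n <= b. *)
Definition divided_power (n : nat) (b t : R) : R := (b - t) ^+ n / n`!%:R.

Lemma divided_power_derive n b t :
  is_derive (t : R^o) (1 : R^o) (fun t : R^o => - divided_power n.+1 b t : R^o)
    (divided_power n b t).
Proof.
have -> : (fun t : R^o => - divided_power n.+1 b t : R^o) =
    (- (n.+1`!%:R^-1)) *: ((cst b - id) ^+ n.+1 : R^o -> R^o).
  apply/funext => u; rewrite /divided_power -mulNr mulrC mulrN -mulNr.
  by rewrite exprfctE.
apply: is_derive_eq.
rewrite /divided_power /GRing.scale /=.
have n0 : (n`!%:R : R) != 0 by rewrite pnatr_eq0 -lt0n fact_gt0.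
have n1 : (n.+1%:R : R) != 0 by rewrite pnatr_eq0.
rewrite factS natrM sub0r; field.
by move: n1; rewrite n0 -natr1 addrC.
Qed.

Lemma divided_power_continuous n (b : R) : continuous (divided_power n b).
Proof.
move=> t; apply: cvgM; last exact: cvg_cst.
have bt : (fun t : R => b - t) @ t --> b - t.
  by apply: cvgB; [exact: cvg_cst|exact: cvg_id].
elim: n => [|n IH]; first by under eq_fun do rewrite expr0; exact: cvg_cst.
by under eq_fun do rewrite exprS; rewrite exprS; exact: cvgM.
Qed.

Lemma integral_divided_power n (a b : R) : a <= b ->
  \int[mu]_(t in `[a, b]) divided_power n b t = divided_power n.+1 b a.
Proof.
rewrite le_eqVlt => /predU1P[->|ab].
  by rewrite set_itv1 Rintegral_set1 /divided_power subrr expr0n mul0r.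
rewrite /Rintegral (@continuous_FTC2 _ _ (fun t => - divided_power n.+1 b t))//=.
- by rewrite /divided_power subrr expr0n mul0r oppr0 sub0r opprK.
- by apply: continuous_subspaceT => t; exact: divided_power_continuous.
- split.
  + by move=> t _; have := divided_power_derive n b t => /@ex_derive.
  + apply: cvg_at_right_filter; apply: cvgN; exact: divided_power_continuous.
  + apply: cvg_at_left_filter; apply: cvgN; exact: divided_power_continuous.
- by move=> t _; rewrite derive1E; have := divided_power_derive n b t => /@derive_val.
Qed.

Section SimplexIntegral.
Variables (V : Type) (N : nat).
Local Notation C := (R[i]).
Local Notation form := (mxform R V N).

Lemma cintegral_scaler (a b : R) (f : R -> R) (z : C) :
  mu.-integrable `[a, b] (EFin \o f) ->
  cintegral a b (fun t => ((f t)%:C)%C * z) =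
  ((\int[mu]_(t in `[a, b]) f t)%:C)%C * z.
Proof.
move=> fi; rewrite /cintegral.
under eq_Rintegral do rewrite complex_ReM /= mul0r subr0.
under [X in Complex _ X]eq_Rintegral do rewrite complex_ImM /= mul0r addr0.
rewrite !RintegralZr//.
by apply/eqP; rewrite eq_complex complex_ReM complex_ImM /= !mul0r subr0 addr0 !eqxx.
Qed.

(** The inner integral is a scalar multiple of a constant form, so the outer variable integrates
    only the volume of the remaining simplex. *)
Lemma simplex_integral_cst (a b : R) (X : seq form) : a <= b ->
  simplex_integral a b [seq (fun=> x) | x <- X] =
  ((divided_power (size X) b a)%:C)%C *: \prod_(x <- X) x.
Proof.
elim: X a => [|x X IH] a ab /=.
  by rewrite big_nil /divided_power expr0 fact0 divr1 scale1r.
rewrite big_cons; apply/funext => vs; apply/matrixP => i j.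
rewrite /form_integral /mxintegral mxE.
rewrite form_scaleE !mxE -integral_divided_power// -cintegral_scaler; last first.
  apply: continuous_compact_integrable; first exact: segment_compact.
  by apply: continuous_subspaceT => t; exact: divided_power_continuous.
congr Complex; apply: eq_Rintegral => t; rewrite inE/= in_itv/= => /andP[at_ tb].
- by rewrite (IH t tb) wedgeZr form_scaleE mxE.
- by rewrite (IH t tb) wedgeZr form_scaleE mxE.
Qed.

End SimplexIntegral.
End SimplexVolume.

(** * Series with at most one nonzero term *)

Section EventuallyConstant.
Variables (R : realType) (N : nat).
Local Notation C := (R[i]).

Lemma limn_eventually_cst (u : nat -> R^o) (l : R) (L0 : nat) :
  (forall L, (L0 <= L)%N -> u L = l) -> limn u = l.
Proof.
move=> ul; apply/cvg_lim => //; apply: cvg_near_cst.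
by exists L0 => // L /= /ul.
Qed.

Lemma climit_eventually_cst (u : nat -> C) (l : C) (L0 : nat) :
  (forall L, (L0 <= L)%N -> u L = l) -> climit u = l.
Proof.
move=> ul; apply/eqP; rewrite eq_complex /climit /=.
rewrite (@limn_eventually_cst _ (complex.Re l) L0) => [|L /ul ->//].
by rewrite (@limn_eventually_cst _ (complex.Im l) L0) ?eqxx// => L /ul ->.
Qed.

Lemma mxlimit_eventually_cst (u : nat -> 'M[C]_N) (l : 'M[C]_N) (L0 : nat) :
  (forall L, (L0 <= L)%N -> u L = l) -> mxlimit u = l.
Proof.
move=> ul; apply/matrixP => i j; rewrite mxE.
by apply: (@climit_eventually_cst _ _ L0) => L /ul ->.
Qed.

Lemma sum_nat_single (V : nmodType) (F : nat -> V) (k L : nat) : (k < L)%N ->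
  (forall n, n != k -> F n = 0) -> \sum_(0 <= n < L) F n = F k.
Proof.
move=> kL F0; rewrite big_mkord (bigD1 (Ordinal kL)) //= big1 ?addr0// => n nk.
exact: F0.
Qed.

Lemma climit_series_single (F : nat -> C) (k : nat) :
  (forall n, n != k -> F n = 0) -> climit (fun L => \sum_(0 <= n < L) F n) = F k.
Proof.
move=> F0; apply: (@climit_eventually_cst _ _ k.+1) => L kL.
exact: sum_nat_single.
Qed.

Lemma mxseries_single (F : nat -> 'M[C]_N) (k : nat) :
  (forall n, n != k -> F n = 0) -> mxseries F = F k.
Proof.
move=> F0; apply: (@mxlimit_eventually_cst _ _ k.+1) => L kL.
exact: sum_nat_single.
Qed.

Lemma mxintegral0 (a b : R) : mxintegral a b (fun=> 0 : 'M[C]_N) = 0.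
Proof.
apply/matrixP => i j; rewrite !mxE /cintegral.
by rewrite !Rintegral_cst//= !mul0r.
Qed.

End EventuallyConstant.

(** A term survives only if every position lies in [J] or equals [q]. As [q] is outside [J], this
    forces [J] to be the complement of [q], and its cardinal fixes that of [S]. *)
Lemma sum_subsets (S : finType) (V : nmodType) (k : nat) (F : {set S} -> S -> V) :
  (forall (J : {set S}) q x, x \notin J -> x != q -> F J q = 0) ->
  \sum_(J : {set S} | #|J| == k) \sum_(q | q \notin J) F J q =
  if #|S| == k.+1 then \sum_q F (finset.setC (finset.set1 q)) q else 0.
Proof.
move=> F0; rewrite (exchange_big_dep xpredT) //=.
transitivity (\sum_q if #|S| == k.+1 then F (finset.setC (finset.set1 q)) q else 0); last first.
  by case: ifP => // _; rewrite big1.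
apply: eq_bigr => q _.
have cardq : #|finset.setC (finset.set1 q)| = #|S|.-1 by rewrite cardsC1.
rewrite big_mkcond (bigD1 (finset.setC (finset.set1 q))) //= big1 ?addr0 => [|J Jq].
  rewrite !finset.inE negbK eqxx andbT cardq.
  (* The element [q] shows that [S] is nonempty, so its cardinal has a genuine predecessor. *)
  by have /prednK {2}<- : (0 < #|S|)%N by apply/card_gt0P; exists q.
case: ifP => // /andP[_ qJ].
have /existsP[x /andP[xJ xq]] : [exists x, (x \notin J) && (x != q)].
  apply/contraT; rewrite negb_exists => /forallP Jx.
  case/eqP: Jq; apply/setP => x; rewrite !finset.inE.
  have := Jx x; rewrite negb_and !negbK; case: eqVneq => [->|_]; rewrite ?orbF//.
  by rewrite (negbTE qJ).
exact: F0 xJ xq.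
Qed.

Section Conjugation.
Variables (A : pzRingType) (u u' : A).
Hypotheses (u'u : u' * u = 1) (uu' : u * u' = 1).

Lemma prod_conj I (r : seq I) (F : I -> A) :
  \prod_(i <- r) (u' * F i * u) = u' * \prod_(i <- r) F i * u.
Proof.
elim: r => [|i r IH]; first by rewrite !big_nil mulr1 u'u.
by rewrite !big_cons IH !mulrA -(mulrA _ u u') uu' mulr1.
Qed.
End Conjugation.

Section FormWords.
Variables (R : realType) (V : Type) (N : nat).
Local Notation form := (mxform R V N).

(** Each word has one letter of degree 1 and [n] letters of degree 2. *)
Lemma homogeneous_words (a b : form) n : homogeneous 1 a -> homogeneous 2 b ->
  homogeneous n.*2.+1 (words a b n.+1).
Proof.
move=> ha hb; have hX k : homogeneous k.*2 (b ^+ k).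
  elim: k => [|k IH]; first exact: homogeneous1.
  by rewrite exprS doubleS -add2n; exact: homogeneousM.
elim: n => [|n IH].
  rewrite wordsS words0 mulr0 addr0 expr0 mulr1; exact: ha.
rewrite wordsS => vs hvs; rewrite form_addE (homogeneousM ha (hX _))//.
by rewrite (homogeneousM hb IH) ?addr0.
Qed.

Definition fcontinuous (w : R -> form) := forall vs, mxcontinuous (fun s => w s vs).

Lemma fcontinuousM w1 w2 : fcontinuous w1 -> fcontinuous w2 ->
  fcontinuous (fun s => w1 s * w2 s).
Proof.
move=> c1 c2 vs i j.
rewrite (_ : (fun s => _) = (fun s => \sum_(m : (size vs).-tuple bool)
  (-1) ^+ inversions m * (w1 s (mask m vs) *m w2 s (mask (map negb m) vs)) i j)).
  apply: ccontinuous_sum => m; apply: ccontinuousM; first exact: ccontinuous_cst.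
  exact: mxcontinuousM.
by apply/funext => s; rewrite -wedgeE summxE; apply: eq_bigr => m _; rewrite mxE.
Qed.

Lemma fcontinuous_cst w : fcontinuous (fun=> w).
Proof. by move=> vs i j; exact: ccontinuous_cst. Qed.

Lemma fcontinuousD w1 w2 : fcontinuous w1 -> fcontinuous w2 ->
  fcontinuous (fun s => w1 s + w2 s).
Proof.
move=> c1 c2 vs i j.
rewrite (_ : (fun s => _) = (fun s => w1 s vs i j + w2 s vs i j)).
  exact: (ccontinuousD (c1 vs i j) (c2 vs i j)).
by apply/funext => s; rewrite form_addE mxE.
Qed.

Lemma fcontinuous_words a b n : fcontinuous a -> fcontinuous b ->
  fcontinuous (fun s => words (a s) (b s) n).
Proof.
move=> ca cb; have cX k : fcontinuous (fun s => b s ^+ k).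
  elim: k => [|k IH]; first exact: fcontinuous_cst.
  by under eq_fun do rewrite exprS; exact: fcontinuousM.
elim: n => [|n IH]; first by under eq_fun do rewrite words0; exact: fcontinuous_cst.
under eq_fun do rewrite wordsS.
by apply: fcontinuousD; apply: fcontinuousM.
Qed.

End FormWords.

Lemma pullback_simplex_integral (R : realType) (V W : Type) (N : nat) (f : V -> W)
    (a b : R) (X : seq (R -> mxform R W N)) :
  pullback f (simplex_integral a b X) =
  simplex_integral a b [seq (fun t => pullback f (Y t)) | Y <- X].
Proof.
elim: X a => [|Y X IH] a /=; first exact: pullback_form0.
apply/funext => vs; rewrite /pullback /form_integral; congr mxintegral.
apply/funext => t; rewrite -IH.
by rewrite -[LHS]/(pullback f (wedge (Y t) (simplex_integral t b X)) vs) wedgeE pullbackM.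
Qed.

(** * Comparison of a path with its smooth pieces *)

Section PathLocality.
Variables (R : realType) (n : nat) (M : manifold R n) (N : nat).
Variable E : vbundle M N.
Local Notation C := (R[i]).
Implicit Types (nabla : connection E) (i j : triv E) (x : M).

Lemma curvatureE nabla i x : curvature nabla i (x := x) =
  form2 (fun v w => conn_ext nabla i v w + (conn_mx nabla i v *m conn_mx nabla i w -
    conn_mx nabla i w *m conn_mx nabla i v)).
Proof.
apply/funext => -[|v [|w [|u vs]]]; try exact: homogeneous_curvature.
exact: curvature2.
Qed.

(** The curvature at [x] depends on the germ of the connection matrices along M only, for a single
    value of s. *)
Lemma curvature_eq nabla1 nabla2 i x :
  (forall y (v : tangent y), tdom i y -> conn_mx nabla1 i v = conn_mx nabla2 i v) ->
  tdom i x -> curvature nabla1 i (x := x) = curvature nabla2 i (x := x).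
Proof.
move=> conn12 ix.
have extE (u u' : tangent x) :
    mxderive u (conn_chart nabla1 i (chart_at x) u') (coord (chart_at x) x) =
    mxderive u (conn_chart nabla2 i (chart_at x) u') (coord (chart_at x) x).
  apply: near_eq_mxderive; near=> y.
  have [x' [cx' ix'] <-] : (coord (chart_at x) @` (dom (chart_at x) `&` tdom i)) y.
    by near: y; apply: near_chart => //; [exact: tdom_open|exact: chart_atP].
  by rewrite !conn_chartE coordK// conn12.
have conn_ext12 (v w : tangent x) : conn_ext nabla1 i v w = conn_ext nabla2 i v w.
  exact (etrans (conn_extE nabla1 i v w) (etrans
    (f_equal2 (fun p q : 'M[C]_N => p - q) (extE v w) (extE w v))
    (esym (conn_extE nabla2 i v w)))).
rewrite (curvatureE nabla1) (curvatureE nabla2); congr form2.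
apply/funext => v; apply/funext => w.
by rewrite conn_ext12 (conn12 x v ix) (conn12 x w ix).
Unshelve. all: by end_near. Qed.

(** The derivative in s is two-sided, so agreement on a closed piece determines it in the interior
    only. *)
Lemma conn_derivative_eq (nabla D : R -> connection E) (a b : R) s i x :
  (forall s' (v : tangent x), a <= s' <= b -> conn_mx (nabla s') i v = conn_mx (D s') i v) ->
  a < s < b -> conn_derivative nabla s i (x := x) = conn_derivative D s i (x := x).
Proof.
move=> nD /andP[a_s s_b]; rewrite !conn_derivativeE; congr form1; apply/funext => v.
apply: near_eq_mxderive; near=> s'; apply: nD.
apply/andP; split; apply: ltW; near: s'.
- exact: (@lt_nbhsr R a s a_s).
- exact: (@lt_nbhsl R s b s_b).
Unshelve. all: by end_near. Qed.

Lemma mxdifferentiable_continuous (F : R -> 'M[C]_N) :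
  (forall s, mxdifferentiable (F : R^o -> 'M[C]_N) (s : R^o)) -> mxcontinuous F.
Proof.
move=> Fd a b; split=> s; have [Fr Fi] := Fd s a b.
- exact: (differentiable_continuous Fr).
- exact: (differentiable_continuous Fi).
Qed.

Section SmoothPath.
Variables (D : R -> connection E) (D_smooth : smooth_path D).

Lemma fcontinuous_conn_derivative i x : tdom i x ->
  fcontinuous (fun s => conn_derivative D s i (x := x)).
Proof.
move=> ix [|v [|w vs]] //=; try exact: mxcontinuous_cst.
apply: mxdifferentiable_continuous => s.
exact: path_conn_derive_differentiable.
Qed.

Lemma fcontinuous_curvature i x : tdom i x ->
  fcontinuous (fun s => curvature (D s) i (x := x)).
Proof.
move=> ix vs; under eq_fun do rewrite curvatureE.
case: vs => [|v [|w [|u vs]]]; try exact: mxcontinuous_cst.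
have connc (u : tangent x) : mxcontinuous (fun s => conn_mx (D s) i u).
  by apply: mxdifferentiable_continuous => s; exact: path_conn_differentiable.
have extc : mxcontinuous (fun s => conn_ext (D s) i v w).
  by apply: mxdifferentiable_continuous => s; exact: path_conn_ext_differentiable.
have vw := mxcontinuousM (connc v) (connc w).
have wv := mxcontinuousM (connc w) (connc v).
move=> a b.
rewrite (_ : (fun s => _) = (fun s => conn_ext (D s) i v w a b +
    ((conn_mx (D s) i v *m conn_mx (D s) i w) a b +
     (-1) * (conn_mx (D s) i w *m conn_mx (D s) i v) a b))).
  apply: (ccontinuousD (extc a b)); apply: (ccontinuousD (vw a b)).
  exact: (ccontinuousM (@ccontinuous_cst R (-1)) (wv a b)).
by apply/funext => s; rewrite mulN1r mxE [X in _ + X]mxE [X in _ + (_ + X)]mxE.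
Qed.

End SmoothPath.
End PathLocality.

(** * Restriction to constant loops *)

Lemma prod_eq0 (A : pzRingType) (I : eqType) (r : seq I) (F : I -> A) y :
  y \in r -> F y = 0 -> \prod_(i <- r) F i = 0.
Proof.
move=> + Fy; elim: r => // z r IH; rewrite inE big_cons => /predU1P[<-|/IH ->].
  by rewrite Fy mul0r.
by rewrite mulr0.
Qed.

Section ConstantLoop.
Variables (R : realType) (n : nat) (M : manifold R n) (N : nat).
Variables (E : vbundle M N) (nabla : R -> connection E) (x : M).
Local Notation C := (R[i]).
Local Notation form := (mxform R (tangent x) N).

(** For k >= 1, the part of degree 2k - 1 of the Chern-Simons integrand, read in the frame [i]. *)
Definition CS_form (i : triv E) (k : nat) (s : R) : form :=
  (k`!)%:R^-1 *: words (conn_derivative nabla s i (x := x)) (curvature (nabla s) i (x := x)) k.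

Lemma homogeneous_CS_form i k s : homogeneous k.*2.+1 (CS_form i k.+1 s).
Proof.
apply: homogeneousZ; apply: homogeneous_words; last exact: homogeneous_curvature.
exact: homogeneous_form1.
Qed.

Lemma CS_formE vs : CS nabla vs =
  \tr (mxintegral 0 1 (fun s => mxseries (fun k => CS_form (triv_at E x) k.+1 s vs))).
Proof.
apply: (f_equal (fun F => \tr (mxintegral 0 1 F))); apply/funext => s.
apply: (f_equal (@mxseries R N)); apply/funext => k.
by rewrite /CS_form form_scaleE /words form_sumE.
Qed.

Lemma velocity_constant_loop t : velocity (constant_loop x) t = 0.
Proof. exact (@derive_cst R R^o 'rV[R]_n (coord (chart_at x) x) (t : R^o) (1 : R^o)). Qed.

Section Adapted.
Variables (p : nat) (i : 'I_p.+1 -> triv E) (i0 : triv E) (s : R).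
Hypotheses (ix : forall r, tdom (i r) x) (i0x : tdom i0 x).
(** Assumed for the given [s], since it will be available between breakpoints only; the law for the
    curvature holds at every [s]. *)
Hypothesis gauge_derivative : forall r,
  form0 (gtrans i0 (i r) x) * (conn_derivative nabla s (i r) (x := x)) =
  (conn_derivative nabla s i0 (x := x) : form) * form0 (gtrans i0 (i r) x).

Let h r : form := form0 (gtrans i0 (i r) x).
Let h' r : form := form0 (gtrans (i r) i0 x).
Let A : form := conn_derivative nabla s i0 (x := x).
Let B : form := curvature (nabla s) i0 (x := x).

Let hh' r : h r * h' r = 1.
Proof. by rewrite form0M gtrans_mul// gtrans_id. Qed.

Let h'h r : h' r * h r = 1.
Proof. by rewrite form0M gtrans_mul// gtrans_id. Qed.

(** The letters as seen in the reference frame, with 0 for the contraction by the zero velocity. *)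
Let letter m (J : {set {r : 'I_p.+1 & 'I_(m r)}}) (q : {r : 'I_p.+1 & 'I_(m r)})
    (r : 'I_p.+1) (j : 'I_(m r)) : form :=
  let rj := Tagged (fun r => 'I_(m r)) j in
  if rj \in J then B else if rj == q then A else 0.

Lemma pullback_letter m (J : {set {r : 'I_p.+1 & 'I_(m r)}}) q r (j : 'I_(m r)) t :
  pullback (@constant_field _ _ _ x)
    (BCS_letter nabla (gamma := constant_loop x) i s J q j t) =
  h' r * letter J q j * h r.
Proof.
have ev_cst (w : forall y : M, mxform R (tangent y) N) :
    pullback (@constant_field _ _ _ x) (ev_pullback (gamma := constant_loop x) w t) = w x.
  apply/funext => vs; rewrite /pullback /ev_pullback -map_comp.
  by rewrite -[in RHS](map_id vs).
have conjE (Y Y' : form) : h r * Y = Y' * h r -> Y = h' r * Y' * h r.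
  by move=> E1; rewrite -mulrA -E1 mulrA h'h mul1r.
rewrite /BCS_letter /letter; case: ifP => _; last case: ifP => _.
- by rewrite ev_cst; apply: conjE; exact: gauge_curvature.
- by rewrite ev_cst; apply: conjE; exact: gauge_derivative.
- rewrite pullback_form0 mulr0 mul0r.
  by rewrite velocity_constant_loop conn_mx0//; apply/funext => -[].
Qed.

Lemma pullback_block m (J : {set {r : 'I_p.+1 & 'I_(m r)}}) q r :
  pullback (@constant_field _ _ _ x)
    (BCS_block nabla (gamma := constant_loop x) i s J q r) =
  (p.+1%:R^-1 ^+ m r / (m r)`!%:R) *:
    (h' r * \prod_(j < m r) letter J q j * h r).
Proof.
rewrite /BCS_block pullback_simplex_integral -map_comp.
have -> : [seq ((fun Y t => pullback (@constant_field _ _ _ x) (Y t)) \o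
      (fun j => BCS_letter nabla (gamma := constant_loop x) i s J q j)) j0
      | j0 <- enum 'I_(m r)] =
    [seq (fun=> y) | y <- [seq h' r * letter J q j * h r | j <- enum 'I_(m r)]].
  rewrite -map_comp; apply: eq_map => j; apply/funext => t /=.
  exact: pullback_letter.
rewrite simplex_integral_cst; last first.
  by rewrite ler_pM2r ?invr_gt0 ?ltr0n// ler_nat.
rewrite size_map size_enum_ord big_map; congr (_ *: _).
  (* The interval of the [r]-th block has length (r + 1)/p - r/p = 1/p, where p stands for
     [p.+1]. *)
  rewrite /divided_power -mulrBl -natr1 addrAC subrr add0r mul1r.
  by rewrite rmorphM fmorphV rmorphXn fmorphV !rmorph_nat.
rewrite (prod_conj (h'h r) (hh' r)).
by rewrite [index_enum _]unlock -enumT.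
Qed.

Let term m (J : {set {r : 'I_p.+1 & 'I_(m r)}}) (q : {r : 'I_p.+1 & 'I_(m r)}) :
    mxform R (loop_tangent (constant_loop x)) N :=
  \big[@wedge R (loop_tangent (constant_loop x)) N/form0 1%:M]_(r < p.+1)
    wedge (form0 (gtrans (i (ord_pred r)) (i r) (constant_loop x (r%:R / p.+1%:R))))
          (BCS_block nabla (gamma := constant_loop x) i s J q r).

(** The transition function splits as [h' (ord_pred r) * h r], and [h r] cancels the [h' r] in front
    of the block. The product left over is the one of [prod_telescope]. *)
Lemma pullback_term m (J : {set {r : 'I_p.+1 & 'I_(m r)}}) q :
  pullback (@constant_field _ _ _ x) (term J q) =
  (\prod_(r < p.+1) (p.+1%:R^-1 ^+ m r / (m r)`!%:R)) *:
    (h' ord_max * \prod_(r < p.+1) \prod_(j < m r) letter J q j * h ord_max).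
Proof.
rewrite /term pullback_prod -(prod_telescope _ hh' h'h) -form_prodZ.
apply: eq_bigr => r _; rewrite wedgeE pullbackM pullback_form0 pullback_block.
rewrite form_scalerAr -(gtrans_mul (ix (ord_pred r)) i0x (ix r)) -form0M.
by rewrite -[form0 (gtrans i0 (i r) _)]/(h r) -!mulrA (mulrA (h r)) hh' mul1r.
Qed.

(** A position outside [J] and different from [q] carries the letter 0, so [sum_subsets] applies.
    The sum over the remaining [q] is a sum over the place of A' in a word of length k + 1. *)
Lemma sum_terms m k :
  \sum_(J : {set {r : 'I_p.+1 & 'I_(m r)}} | #|J| == k) \sum_(q | q \notin J)
    pullback (@constant_field _ _ _ x) (term J q) =
  if (\sum_(r < p.+1) m r == k.+1)%N then
    (\prod_(r < p.+1) (p.+1%:R^-1 ^+ m r / (m r)`!%:R)) *: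
      (h' ord_max * words A B k.+1 * h ord_max)
  else 0.
Proof.
under eq_bigr do under eq_bigr do rewrite pullback_term.
rewrite sum_subsets => [|J q y yJ yq]; last first.
  have -> : \prod_(r < p.+1) \prod_(j < m r) letter J q j = 0.
    case: y yJ yq => r j yJ yq; apply: (prod_eq0 (mem_index_enum r)).
    apply: (prod_eq0 (mem_index_enum j)).
    by rewrite /letter (negbTE yJ) (negbTE yq).
  by rewrite mulr0 mul0r scaler0.
have -> : #|{: {r : 'I_p.+1 & 'I_(m r)}}| = (\sum_(r < p.+1) m r)%N.
  rewrite -sum1_card -(sig_big_dep xpredT (fun=> xpredT)
    (fun (r : 'I_p.+1) (j : 'I_(m r)) => 1%N)) /=.
  by apply: eq_bigr => r _; rewrite sum1_card card_ord.
case: eqP => // <-; rewrite -scaler_sumr -mulr_suml -mulr_sumr -sum_tagged_words.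
apply: (f_equal (fun W => _ *: (h' ord_max * W * h ord_max))).
apply: eq_bigr => q _; apply: eq_bigr => r _.
apply: eq_bigr => j _; rewrite /letter !finset.inE.
by case: eqVneq.
Qed.

Lemma BCS_integrand k vs :
  mxmultiseries (fun m : 'I_p.+1 -> nat =>
    \sum_(J : {set {r : 'I_p.+1 & 'I_(m r)}} | #|J| == k) \sum_(q | q \notin J)
      term J q [seq constant_field v | v <- vs]) =
  gtrans (i ord_max) i0 x *m CS_form i0 k.+1 s vs *m gtrans i0 (i ord_max) x.
Proof.
pose W : form := h' ord_max * words A B k.+1 * h ord_max.
(* The entries of a tuple of sum k + 1 are at most k + 1, so the cube {0, ..., L - 1}^p contains all
   such tuples once L >= k + 2. *)
apply: (@mxlimit_eventually_cst _ _ _ _ k.+2) => L kL.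
have termE (m : 'I_p.+1 -> nat) :
    \sum_(J : {set {r : 'I_p.+1 & 'I_(m r)}} | #|J| == k) \sum_(q | q \notin J)
      term J q [seq constant_field v | v <- vs] =
    (if (\sum_(r < p.+1) m r == k.+1)%N then
      (\prod_(r < p.+1) (p.+1%:R^-1 ^+ m r / (m r)`!%:R)) *: W else 0) vs.
  rewrite -sum_terms form_sumE; apply: eq_bigr => J _.
  by rewrite form_sumE.
transitivity (\sum_(f : {ffun 'I_p.+1 -> 'I_L} | (\sum_(r < p.+1) f r == k.+1)%N)
    (\prod_(r < p.+1) (p.+1%:R^-1 ^+ f r / (f r)`!%:R)) *: W vs).
  rewrite [RHS]big_mkcond; apply: eq_bigr => f _; rewrite termE.
  by case: ifP.
(* The side 1/p, added p times, is 1: the multinomial sum is thus 1/(k + 1)!. *)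
have pV : (p.+1%:R^-1 : C) *+ p.+1 = 1 by rewrite -[LHS]mulr_natr mulVf ?pnatr_eq0.
rewrite -scaler_suml sum_prod_exp// pV expr1n div1r.
rewrite /W -!wedgeE wedge_form0r -/(form0 _) wedge_form0l.
by rewrite /CS_form form_scaleE -scalemxAr -scalemxAl.
Qed.

End Adapted.

Lemma BCS_component_constant_loop p (i : 'I_p.+1 -> triv E) k vs :
  piecewise_smooth_path nabla -> (forall r, tdom (i r) x) ->
  BCS_component nabla (gamma := constant_loop x) i k [seq constant_field v | v <- vs] =
  \tr (mxintegral 0 1 (fun s => CS_form (triv_at E x) k.+1 s vs)).
Proof.
move=> [m [sigma [D [s0 sm pieces]]]] ix.
set i0 := triv_at E x; have i0x : tdom i0 x := triv_atP E x.
pose P := gtrans (i ord_max) i0 x; pose Q := gtrans i0 (i ord_max) x.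
have QP : Q *m P = 1%:M by rewrite gtrans_mul// gtrans_id.
have slt l : (l < m)%N -> sigma l < sigma l.+1 by move=> /pieces[].
have derivativeE l s j : (l < m)%N -> sigma l < s < sigma l.+1 -> tdom j x ->
    conn_derivative nabla s j (x := x) = conn_derivative (D l) s j (x := x).
  move=> lm sl jx; have [_ _ nD] := pieces l lm.
  by apply: conn_derivative_eq sl => s' v sl'; exact: nD.
have curvE l s : (l < m)%N -> sigma l < s < sigma l.+1 ->
    curvature (nabla s) i0 (x := x) = curvature (D l s) i0 (x := x).
  move=> lm /andP[sl sl']; have [_ _ nD] := pieces l lm.
  by apply: curvature_eq => // y v yi; apply: nD => //; rewrite !ltW.
have Fm : mxpiecewise m sigma (fun s => CS_form i0 k.+1 s vs).
  move=> l lm; have [_ Ds _] := pieces l lm.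
  exists (fun s => (k.+1`!)%:R^-1 *: words (conn_derivative (D l) s i0 (x := x))
    (curvature (D l s) i0 (x := x)) k.+1 vs) => [a b|s sl]; last first.
    exact (f_equal2 (fun p q : form => (((k.+1`!)%:R^-1 : C) *: words p q k.+1) vs)
      (derivativeE l s i0 lm sl i0x) (curvE l s lm sl)).
  under eq_fun do rewrite mxE.
  apply: ccontinuousM; first exact: ccontinuous_cst.
  apply: fcontinuous_words; [exact: fcontinuous_conn_derivative|exact: fcontinuous_curvature].
have PFQm : mxpiecewise m sigma (fun s => P *m CS_form i0 k.+1 s vs *m Q).
  move=> l lm; have [G Gc FG] := Fm l lm.
  exists (fun s => P *m G s *m Q) => [|s sl]; last by rewrite FG.
  apply: mxcontinuousM; last exact: mxcontinuous_cst.
  by apply: mxcontinuousM => //; exact: mxcontinuous_cst.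
(* Only inside a piece, where A' is the derivative of a smooth path and obeys the gauge law. *)
have integrandE l s : (l < m)%N -> sigma l < s < sigma l.+1 -> forall etas,
    etas = [seq constant_field v | v <- vs] ->
    mxmultiseries (fun m : 'I_p.+1 -> nat =>
      \sum_(J : {set {r : 'I_p.+1 & 'I_(m r)}} | #|J| == k) \sum_(q | q \notin J)
      (\big[@wedge R (loop_tangent (constant_loop x)) N/form0 1%:M]_(r < p.+1)
        wedge (form0 (gtrans (i (ord_pred r)) (i r) (constant_loop x (r%:R / p.+1%:R))))
          (BCS_block nabla (gamma := constant_loop x) i s J q r)) etas) =
    P *m CS_form i0 k.+1 s vs *m Q.
  move=> lm sl _ ->; apply: BCS_integrand => // r.
  have [_ Ds _] := pieces l lm.
  exact (etrans (f_equal (fun p : form => form0 (gtrans i0 (i r) x) * p)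
      (derivativeE l s (i r) lm sl (ix r)))
    (etrans (gauge_conn_derivative Ds s i0x (ix r))
      (f_equal (fun p : form => p * form0 (gtrans i0 (i r) x))
        (esym (derivativeE l s i0 lm sl i0x))))).
(* Regularity of the integrand of [BCS] is inherited from the conjugated Chern-Simons integrand,
   with which it agrees on each open piece. *)
have BFm : mxpiecewise m sigma (fun s => mxmultiseries (fun m : 'I_p.+1 -> nat =>
      \sum_(J : {set {r : 'I_p.+1 & 'I_(m r)}} | #|J| == k) \sum_(q | q \notin J)
      (\big[@wedge R (loop_tangent (constant_loop x)) N/form0 1%:M]_(r < p.+1)
        wedge (form0 (gtrans (i (ord_pred r)) (i r) (constant_loop x (r%:R / p.+1%:R))))
          (BCS_block nabla (gamma := constant_loop x) i s J q r))
        [seq constant_field v | v <- vs])).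
  move=> l lm; have [G Gc FG] := PFQm l lm; exists G => // s sl.
  by rewrite (integrandE l)// FG.
have intE := mxintegral_eq slt BFm PFQm (fun l s lm sl => integrandE l s lm sl _ erefl).
have trE := trace_mxintegral_conj slt Fm QP.
rewrite s0 sm in intE trE.
exact (etrans (f_equal mxtrace intE) trE).
Qed.

Lemma CS_degree vs k : size vs = k.*2.+1 ->
  CS nabla vs = \tr (mxintegral 0 1 (fun s => CS_form (triv_at E x) k.+1 s vs)).
Proof.
move=> vsk; rewrite CS_formE.
apply: (f_equal (fun F => \tr (mxintegral 0 1 F))); apply/funext => s.
apply: mxseries_single => l lk; apply: homogeneous_CS_form.
by rewrite vsk eqSS (inj_eq double_inj) eq_sym.
Qed.

End ConstantLoop.

Theorem proposition4p2 (R : realType) (n N : nat) (M : manifold R n)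
  (E : vbundle M N) (nabla : R -> connection E)
  (hnabla : piecewise_smooth_path nabla) :
  restrict_to_constant (BCS nabla) = CS nabla.
Proof.
apply: functional_extensionality_dep => x; apply/funext => vs.
rewrite /restrict_to_constant /BCS; case: pselect => [ex|[]]; last first.
  (* One trivialization around [x], with p = 1, is adapted to the constant loop; this excludes the
     default branch of [BCS]. *)
  exists (existT (fun p => 'I_p -> triv E) 1%N (fun=> triv_at E x)).
  by split=> // r t _; exact: triv_atP.
(* The chosen pair is now an arbitrary adapted one; adaptedness rules out p = 0. *)
move: (projT1 (cid ex)) (projT2 (cid ex)) => [[|p] i] [] // _ adapted_i.
rewrite [projT2 _]/=.
have ix r : tdom (i r) x.
  (* The loop sits at [x] at all times, so the left endpoint of the [r]-th interval tests
     membership. *)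
  apply: (adapted_i r (r%:R / p.+1%:R)); rewrite lexx /=.
  by rewrite ler_pM2r ?invr_gt0 ?ltr0n// ler_nat.
have componentE k := BCS_component_constant_loop k vs hnabla ix.
have zero_outside k : size vs != k.*2.+1 ->
    \tr (mxintegral 0 1 (fun s => CS_form nabla (triv_at E x) k.+1 s vs)) = 0.
  move=> vsk; rewrite (_ : (fun s => _) = (fun=> 0)) ?mxintegral0 ?mxtrace0//.
  by apply/funext => s; exact: homogeneous_CS_form.
rewrite /BCS_local.
rewrite (_ : (fun L => _) = (fun L => \sum_(0 <= k < L)
    \tr (mxintegral 0 1 (fun s => CS_form nabla (triv_at E x) k.+1 s vs)))); last first.
  by apply/funext => L; apply: eq_bigr => k _; exact: componentE.
have [[k vsk]|no_k] := pselect (exists k, size vs = k.*2.+1).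
  rewrite (CS_degree nabla vsk); apply: climit_series_single => l lk.
  by apply: zero_outside; rewrite vsk eqSS (inj_eq double_inj) eq_sym.
have vs_k k : size vs != k.*2.+1 by apply/eqP => vsk; apply: no_k; exists k.
(* In even degree all terms vanish on both sides, and the index 0 is an arbitrary choice. *)
rewrite (climit_series_single (k := 0)) => [|k _]; last exact: zero_outside.
rewrite zero_outside// CS_formE.
rewrite (_ : (fun s => _) = (fun=> 0)) ?mxintegral0 ?mxtrace0//.
apply/funext => s; rewrite (mxseries_single (k := 0)) => [|k _]; exact: homogeneous_CS_form.
Qed.
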